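(* Let $d\in\mathbb{N}$, let $A\in\mathscr{R}$ be a fixed set, let $r\ge 0$, and let ${\bf D}_r(t)=\sum_{i=1}^{N(t)}{\bf X}^{(i)}e^{-r\tau_i}$ be the discounted aggregate claims, where $\{{\bf X}^{(i)}\}_{i\in\mathbb{N}}$ are i.i.d. non-negative $d$-dimensional claim vectors with common distribution $F$ (generic copy ${\bf X}$) and $\{N(t),\,t\ge0\}$ is a renewal counting process with arrival times $\{\tau_i\}$ and finite renewal function $\lambda(t)=\mathbf{E}[N(t)]$. Assume that the sequence $\{{\bf X}^{(i)},\,i\in\mathbb{N}\}$ and the process $\{N(t),\,t\ge 0\}$ are independent and that $F\in\mathcal{S}_A$. Then for every fixed $T\in\Lambda$, $$\mathbf{P}\left[{\bf D}_r(t)\in x\,A\right]\sim\int_0^t\mathbf{P}\left[{\bf X}\in x\,e^{rs}A\right]\lambda(ds),\qquad x\to\infty,$$ uniformly for all $t\in\Lambda_T=\Lambda\cap(0,T]$.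
   Context: Model. The claim vectors ${\bf X}^{(i)}=(X^{(i)}_1,\dots,X^{(i)}_d)$, $i\in\mathbb{N}$, take values in $[0,\infty)^d$; they may have some zero components but not all components equal to zero. The components of one vector may be arbitrarily dependent. The $i$-th claim vector arrives at time $\tau_i$, with $\tau_0=0$; the inter-arrival times $\theta_i=\tau_i-\tau_{i-1}$, $i\ge1$, are i.i.d., non-negative and not degenerate at zero. $N(t)=\sup\{n:\tau_n\le t\}$ and $\lambda(t)=\mathbf{E}[N(t)]=\sum_{i=1}^\infty\mathbf{P}[\tau_i\le t]<\infty$. $\Lambda=\{t\ge0:\lambda(t)>0\}=\{t\ge 0:\mathbf{P}[\tau_1\le t]>0\}$. Integrals $\int_0^t\cdot\,\lambda(ds)$ are over the closed interval $[0,t]$ (a possible atom of $\lambda$ at $0$ is included), with respect to the measure $B\mapsto\sum_{i\ge1}\mathbf{P}[\tau_i\in B]$. Sets. $\mathscr{R}$ is the family of all sets $A\subsetneq\mathbb{R}^d$ that are open, increasing (i.e. ${\bf x}\in A$ and ${\bf y}\in[0,\infty)^d$ imply ${\bf x}+{\bf y}\in A$), have convex complement $A^c$, and satisfy ${\bf 0}\notin\overline{A}$. For $x>0$, $xA=\{x{\bf a}:{\bf a}\in A\}$. Distribution classes. For $A\in\mathscr{R}$ and a random vector ${\bf X}$ in $[0,\infty)^d$ with distribution $F$, let $Y_A=\sup\{u>0:{\bf X}\in uA\}$ (with $\sup\emptyset=0$), and let $F_A$ be the distribution of $Y_A$; its tail is $\overline{F}_A(x)=1-F_A(x)=\mathbf{P}[{\bf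 X}\in xA]$ for $x>0$. All univariate distributions $V$ in the classes considered satisfy $\overline V(x)>0$ for all $x$. $F\in\mathcal{S}_A$ means that $F_A$ is subexponential: $\lim_{x\to\infty}\overline{F_A^{n*}}(x)/\overline{F}_A(x)=n$ for any (equivalently, some) integer $n\ge2$, where $F_A^{n*}$ is the $n$-fold convolution of $F_A$. Uniformity. $f(x,t)\sim g(x,t)$ uniformly for $t\in E$ means $\lim_{x\to\infty}\sup_{t\in E}\left|f(x,t)/g(x,t)-1\right|=0$. *)

(* Defs.v *)
From HB Require Import structures.
From mathcomp Require Import all_boot all_order all_algebra finmap.
From mathcomp Require Import all_classical all_reals all_analysis measurable_realfun.

Set Implicit Arguments.
Unset Strict Implicit.
Unset Printing Implicit Defensive.

Import Order.TTheory GRing.Theory Num.Theory.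
Import numFieldNormedType.Exports.

Local Open Scope classical_set_scope.
Local Open Scope ring_scope.

(* Borel sigma-algebra of 'M[R]_(m, n), generated by the open sets. *)
#[warnings="-redundant-canonical-projection"]
HB.instance Definition _ (R : realType) (m n : nat) :=
  @isMeasurable.Build (sigma_display (@open 'M[R]_(m, n))) 'M[R]_(m, n)
    <<s (@open 'M[R]_(m, n)) >>
    (@sigma_algebra0 _ setT _) (@sigma_algebraC _ _)
    (@sigma_algebra_bigcup _ setT _).

Section independence.
Context (d d' : measure_display) (T : measurableType d) (U : measurableType d')
  (R : realType) (P : probability T R).

Definition mutually_independent (Y : nat -> {mfun T >-> U}) : Prop :=
  forall (J : {fset nat}) (B : nat -> set U), (forall i, measurable (B i)) ->
    P (\bigcap_(i in [set` J]) Y i @^-1` B i) =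
    (\prod_(i <- J) P (Y i @^-1` B i))%E.

Definition iid (Y : nat -> {mfun T >-> U}) : Prop :=
  mutually_independent Y /\
  forall i (B : set U), measurable B ->
    distribution P (Y i) B = distribution P (Y 0) B.

Definition generated_sigma (I : Type) (D : set I) (Y : I -> T -> U)
    : set (set T) :=
  <<s \bigcup_(i in D) preimage_set_system setT (Y i) measurable >>.

Definition independent_systems (G H : set (set T)) : Prop :=
  forall A B, G A -> H B -> P (A `&` B) = (P A * P B)%E.

End independence.

Section sets.
Context (R : realType) (n : nat).
Implicit Types A : set 'rV[R]_n.

Definition nonneg_vec (v : 'rV[R]_n) : Prop := forall j, 0 <= v 0 j.

Definition increasing_set A : Prop :=
  forall x y, A x -> nonneg_vec y -> A (x + y).

Definition scale_set (c : R) A : set 'rV[R]_n := [set c *: a | a in A].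

(* The family of sets written as a script R in the literature. *)
Definition ruin_family A : Prop :=
  [/\ A `<` setT, open A, increasing_set A,
      convex_set (~` A : set (convex_lmodType 'rV[R]_n)) &
      ~ closure A 0].

(* For A in [ruin_family] the set below is bounded above, and [sup set0 = 0],
   so [sup] is the intended supremum. *)
Definition gauge_sup A (v : 'rV[R]_n) : R :=
  sup [set u | 0 < u /\ scale_set u A v].

End sets.

Section subexponential.
Context (R : realType).
Implicit Types V W : set R -> \bar R.

Definition tail V (x : R) : R := fine (V `]x, +oo[%classic).

Definition convolution V W : set R -> \bar R :=
  fun B => (\int[V]_x W [set y : R | B (x + y)%R])%E.

Definition convolution_power V (k : nat) : set R -> \bar R :=
  iter k (convolution V) (\d_(0 : R)).

Definition subexponential V : Prop :=
  (forall x, 0 < tail V x) /\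
  forall k, (2 <= k)%N ->
    tail (convolution_power V k) x / tail V x @[x --> +oo] --> (k%:R : R).

Definition law_of_gauge (n : nat) (F : set 'rV[R]_n -> \bar R)
    (A : set 'rV[R]_n) : set R -> \bar R :=
  pushforward F (gauge_sup A).

Definition subexponential_wrt (n : nat) (A : set 'rV[R]_n)
    (F : set 'rV[R]_n -> \bar R) : Prop :=
  subexponential (law_of_gauge F A).

(* [ereal_sup set0 = -oo], hence the [maxe 0]: the supremum is taken among
   nonnegative quantities. *)
Definition uniformly_equivalent (f g : R -> R -> R) (E : set R) : Prop :=
  maxe 0%E (ereal_sup [set `|f x t / g x t - 1|%:E | t in E]) @[x --> +oo]
    --> (0%E : \bar R).

End subexponential.

(* Indexing from 0: [theta i] and [X i] are the (i+1)-st inter-arrival time and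
   claim vector, so [X i] is paid at the epoch [arrival theta i.+1]. *)
Section renewal.
Context (d : measure_display) (T : measurableType d) (R : realType)
  (P : probability T R).
Variable theta : nat -> {mfun T >-> R}.

Definition arrival (k : nat) : {mfun T >-> R} := \sum_(i < k) theta i.

Definition counting_process (t : R) (w : T) : \bar R :=
  ereal_sup [set k%:R%:E | k in [set k | arrival k w <= t]].

Definition renewal_function (t : R) : \bar R :=
  (\int[P]_w counting_process t w)%E.

Definition renewal_measure : {measure set R -> \bar R} :=
  mseries (fun k => distribution P (arrival k)) 1.

Definition Lambda : set R := [set t | 0 <= t /\ (0 < renewal_function t)%E].

(* When [counting_process t w] is +oo, a null event if [renewal_function t] is
   finite, the sum below is empty. *)
Definition discounted_claims (n : nat) (X : nat -> T -> 'rV[R]_n) (r t : R)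
    (w : T) : 'rV[R]_n :=
  \sum_(i < Num.truncn (fine (counting_process t w)))
    expR (- (r * arrival i.+1 w)) *: X i w.

End renewal.

(* Main.v *)
From HB Require Import structures.
Require Import Defs.
From mathcomp Require Import all_boot all_order all_algebra finmap.
From mathcomp Require Import all_classical all_reals all_analysis measurable_realfun.
From mathcomp Require Import ring lra.

Set Implicit Arguments.
Unset Strict Implicit.
Unset Printing Implicit Defensive.

Import Order.TTheory GRing.Theory Num.Theory.
Import numFieldNormedType.Exports.

Local Open Scope classical_set_scope.
Local Open Scope ring_scope.

(** The gauge [gauge_sup A] of the closed convex set [~` A] is subadditive,
    positively homogeneous, and [v] lies in [x A] exactly when its gauge exceeds
    [x]. Write [Y k] for the gauge of the [k]-th claim, [tau k] for the [k]-th
    arrival time, [Fb] for the tail of [Y k] and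
      [E k = large_claim x t k = { x * expR (r * tau k.+1) < Y k, tau k.+1 <= t }].
    Integrating the independence of claims and arrivals shows that the
    right-hand side is the series of the probabilities of the [E k]
    ([integral_renewal_measure]). Up to the null event of infinitely many
    arrivals, the event on the left contains every [E k], because [A] is
    increasing ([large_claim_event]); it is contained in the event that the
    discounted sum of the [Y k] exceeds [x], because the gauge is subadditive
    ([claims_event_discounted_sum]). So the problem is one-dimensional.

    Lower bound ([claims_lower_bound]). If [E k] and [E j] with [k < j] both
    occur, then [Y j] exceeds [x] and a further [j - k] arrivals fit into a time
    interval of length [T], independently of [E k]. Summing over [j], the
    overlaps cost at most the fraction [Fb x * lambda T] of the series. This
    tends to [0] and depends on [t] only through [T].

    Upper bound ([claims_upper_bound]). Discount factors lie between
    [expR (- r T)] and [1]. For a bounded number [m] of claims, either all claims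
    but one add up to at most [K], so that the remaining one exceeds the level up
    to a constant, which long-tailedness absorbs ([tail_long]); or no claim
    dominates, an event that subexponentiality makes negligible uniformly in the
    level ([single_big_jump]). For more than [m] claims all discount factors are
    replaced by the first one, and Kesten's bound [C * (1 + e) ^+ k * Fb u] for
    the tail of [k] claims ([kesten_bound]) is beaten by the geometric decay of
    [P (tau k <= T)] ([geometric_moment]).

    Levels are random because they depend on the arrival times. Every estimate
    for a fixed level is transferred to a random one by conditioning on the
    arrivals ([indep_on_gt_le], [pr_gt_le]): a comparison of tails valid at each
    fixed level survives at an independent random level. This is what makes all
    bounds uniform in [t]. *)

(** * Product laws and conditioning on an independent variable *)

Section independence_theory.
Context (d : measure_display) (W : measurableType d) (R : realType)
  (P : probability W R).
Implicit Types (U Z : W -> R) (B D E : set W).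

Lemma measurable_preimage d' (W' : measurableType d') (Z : W' -> R) (S : set R) :
  measurable_fun setT Z -> measurable S -> measurable (Z @^-1` S).
Proof. by move=> mZ mS; rewrite -[X in measurable X]setTI; exact: mZ. Qed.

Lemma measurable_gt d' (W' : measurableType d') (Z U : W' -> R) :
  measurable_fun setT Z -> measurable_fun setT U ->
  measurable [set w | U w < Z w].
Proof.
move=> mZ mU.
rewrite (_ : [set _ | _] = (fun w => Z w - U w) @^-1` `]0, +oo[%classic); last first.
  by apply/seteqP; split=> w /=; rewrite in_itv/= andbT subr_gt0.
by apply: measurable_preimage => //; exact: measurable_funB.
Qed.

Lemma measurable_le d' (W' : measurableType d') (Z U : W' -> R) :
  measurable_fun setT Z -> measurable_fun setT U ->
  measurable [set w | Z w <= U w].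
Proof.
move=> mZ mU.
rewrite (_ : [set _ | _] = ~` [set w | U w < Z w]); last first.
  by apply/seteqP; split=> w /=; rewrite leNgt => /negP.
by apply: measurableC; exact: measurable_gt.
Qed.

(** The law of [U] on the event [B]. The proofs [mU] and [mB] are arguments so
    that canonical structures can find the measure structure. *)
Definition law_on U B (mU : measurable_fun setT U) (mB : measurable B) :
  set R -> \bar R := fun S => P (U @^-1` S `&` B).

Section law_on_measure.
Variables (U : W -> R) (B : set W).
Hypotheses (mU : measurable_fun setT U) (mB : measurable B).

Let law0 : law_on mU mB set0 = 0%E.
Proof. by rewrite /law_on preimage_set0 set0I measure0. Qed.

Let law_ge0 S : (0 <= law_on mU mB S)%E.
Proof. exact: measure_ge0. Qed.

Let law_additive : semi_sigma_additive (law_on mU mB).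
Proof.
move=> F mF tF mUF; rewrite /law_on preimage_bigcup setI_bigcupl.
apply: measure_semi_sigma_additive.
- by move=> n; apply: measurableI => //; exact: measurable_preimage.
- apply/trivIsetP => i j _ _ ij; rewrite setIACA -preimage_setI.
  by move/trivIsetP : tF => /(_ _ _ _ _ ij) ->//; rewrite preimage_set0 set0I.
- rewrite -setI_bigcupl -preimage_bigcup.
  by apply: measurableI => //; exact: measurable_preimage.
Qed.

HB.instance Definition _ := isMeasure.Build _ _ _ (law_on mU mB)
  law0 law_ge0 law_additive.

Let law_finite : fin_num_fun (law_on mU mB).
Proof.
move=> S mS; apply: fin_num_measure.
by apply: measurableI => //; exact: measurable_preimage.
Qed.

HB.instance Definition _ := Measure_isFinite.Build _ _ _ (law_on mU mB)
  law_finite.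

Lemma ge0_integral_law_on (f : R -> \bar R) :
  measurable_fun setT f -> (forall u, 0 <= f u)%E ->
  (\int[law_on mU mB]_u f u = \int[P]_(w in B) f (U w))%E.
Proof.
move=> mf f0.
have mfU : measurable_fun setT (f \o U) by exact: measurableT_comp.
transitivity (\int[pushforward (mrestr P mB) U]_u f u)%E.
  exact: eq_measure_integral.
rewrite ge0_integral_pushforward// preimage_setT.
rewrite (@ge0_negligible_integral _ _ _ _ _ (~` B))//=; last 2 first.
- exact: measurableC.
- by rewrite /mrestr setICl measure0.
rewrite setTD setCK; apply: eq_measure_integral => A mA AB.
by rewrite /= /mrestr setIidl.
Qed.

End law_on_measure.

(** The events [B] and [D] ride along with [U] and [Z]: truncating to events such
    as [tau k <= t] then needs no conditional probabilities. *)
Definition indep_on U B Z D : Prop :=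
  forall S S' : set R, measurable S -> measurable S' ->
    P ((U @^-1` S `&` B) `&` (Z @^-1` S' `&` D)) =
    (P (U @^-1` S `&` B) * P (Z @^-1` S' `&` D))%E.

(** Fubini: on [B `&` D] the joint law of [U] and [Z] agrees on rectangles, hence
    everywhere, with the product of the two truncated laws. *)
Lemma indep_on_section U B Z D (C : set (R * R)) :
  measurable_fun setT U -> measurable_fun setT Z ->
  measurable B -> measurable D -> measurable C -> indep_on U B Z D ->
  P ([set w | C (U w, Z w)] `&` (B `&` D)) =
  (\int[P]_(w in B) P ([set v | C (U w, Z v)] `&` D))%E.
Proof.
move=> mU mZ mB mD mC UZ.
have mUZ : measurable_fun setT (fun w => (U w, Z w)) by exact: measurable_fun_pair.
have mBD : measurable (B `&` D) by exact: measurableI.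
pose UZ' w := (U w, Z w).
have prodE S S' : measurable S -> measurable S' ->
    pushforward (mrestr P mBD) UZ' (S `*` S') =
    (law_on mU mB S * law_on mZ mD S')%E.
  move=> mS mS'; rewrite /law_on -UZ// /pushforward/= /mrestr.
  by congr (P _); rewrite setIACA.
transitivity (pushforward (mrestr P mBD) UZ' C) => //.
rewrite -(@product_measure_unique _ _ _ _ R (law_on mU mB) (law_on mZ mD)
  (pushforward (mrestr P mBD) UZ') prodE C mC).
rewrite /product_measure1 ge0_integral_law_on//; last first.
  exact: (@measurable_fun_xsection _ _ _ _ R (law_on mZ mD)).
apply: eq_integral => w _; rewrite /= /law_on; congr (P (_ `&` _)).
by apply/seteqP; split => v /=; rewrite /xsection/= inE.
exact: mUZ.
Qed.

(** Conditioning on [U], a comparison of the tails of [Z] and [Z'] at the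
    levels taken by [U] survives when the level is random. *)
Lemma indep_on_gt_le U B Z D Z' D' (k : \bar R) :
  measurable_fun setT U -> measurable_fun setT Z -> measurable_fun setT Z' ->
  measurable B -> measurable D -> measurable D' ->
  indep_on U B Z D -> indep_on U B Z' D' -> (0 <= k)%E ->
  (forall w, B w -> P ([set v | U w < Z v]%R `&` D) <=
                    k * P ([set v | U w < Z' v]%R `&` D'))%E ->
  (P ([set w | U w < Z w]%R `&` (B `&` D)) <=
   k * P ([set w | U w < Z' w]%R `&` (B `&` D')))%E.
Proof.
move=> mU mZ mZ' mB mD mD' UZ UZ' k0 cmp.
have mC : measurable [set x : R * R | x.1 < x.2].
  exact: (@measurable_gt _ _ snd fst).
have mint V E (mV : measurable_fun setT V) (mE : measurable E) :
    measurable_fun B (fun w => P ([set v | U w < V v] `&` E)).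
  apply: measurable_funTS.
  have := measurableT_comp
    (@measurable_fun_xsection _ _ _ _ R (law_on mV mE) _ mC) mU.
  congr measurable_fun; apply/funext => w /=; rewrite /law_on.
  by congr (P (_ `&` _)); apply/seteqP; split => v /=; rewrite /xsection/= inE.
have e1 := indep_on_section mU mZ mB mD mC UZ.
have e2 := indep_on_section mU mZ' mB mD' mC UZ'.
rewrite /= in e1 e2; rewrite e1 e2 -ge0_integralZl//; last exact: mint.
apply: ge0_le_integral => //; first exact: mint.
by apply: emeasurable_funM => //; exact: mint.
Qed.

Lemma indep_on_systems (G H : set (set W)) U B Z D :
  independent_systems P G H ->
  (forall S, measurable S -> G (Z @^-1` S `&` D)) ->
  (forall S, measurable S -> H (U @^-1` S `&` B)) ->
  indep_on U B Z D.
Proof.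
move=> GH GZ HU S S' mS mS'.
by rewrite setIC (GH _ _ (GZ _ mS') (HU _ mS)) muleC.
Qed.

End independence_theory.

(** * Independence of disjoint blocks of variables *)

Section grouping.
Context (d d' : measure_display) (W : measurableType d)
  (U : measurableType d') (R : realType) (P : probability W R).

(** For fixed [B] in [H], the finite measures [A |-> P (A `&` B)] and
    [A |-> P A * P B] agree on the intersection-closed system [G], hence on the
    sigma-algebra that it generates. *)
Lemma independent_systems_generated (G H : set (set W)) :
  G `<=` measurable -> H `<=` measurable -> setI_closed G -> G setT ->
  independent_systems P G H -> independent_systems P <<s G >> H.
Proof.
move=> mG mH GI GT GH A B GA HB.
have mB : measurable B by exact: mH.
have PB0 : 0 <= fine (P B) by rewrite fine_ge0.
have PBE : (fine (P B))%:E = P B by rewrite fineK// fin_num_measure.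
have := @g_sigma_algebra_measure_unique _ R W G mG (fun=> setT) (fun=> GT) _
  (mrestr P mB) (mscale (NngNum PB0) P) GI _ _ A GA.
rewrite /= /mscale /= /mrestr PBE muleC; apply.
- by rewrite bigcup_const.
- by move=> C GC; rewrite GH// muleC.
- by move=> _; rewrite setTI -PBE ltry.
Qed.

Lemma independent_systemsC (G H : set (set W)) :
  independent_systems P G H -> independent_systems P H G.
Proof. by move=> GH A B HA GB; rewrite setIC GH// muleC. Qed.

Variable Y : nat -> {mfun W >-> U}.
Implicit Types J : set nat.

(** An intersection-closed system generating the sigma-algebra of the [Y i] with
    [i] in [J], on which mutual independence is a statement about products. *)
Definition cylinders J : set (set W) := [set A | exists (K : {fset nat}) B,
  [/\ [set` K] `<=` J, forall i, measurable (B i) &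
      A = \bigcap_(i in [set` K]) Y i @^-1` B i]].

Lemma cylinders_measurable J : cylinders J `<=` measurable.
Proof.
move=> A [K [B [_ mB ->]]]; apply: fin_bigcap_measurable => // i _.
by rewrite -[X in measurable X]setTI; exact: measurable_funP.
Qed.

Lemma cylindersT J : cylinders J setT.
Proof.
exists fset0, (fun=> setT); split => //.
by apply/seteqP; split=> w //= _ i /=; rewrite inE.
Qed.

Lemma cylindersI J : setI_closed (cylinders J).
Proof.
move=> _ _ [K [B [KJ mB ->]]] [L [C [LJ mC ->]]].
exists (K `|` L)%fset, (fun i => (if i \in K then B i else setT) `&`
  (if i \in L then C i else setT)); split.
- by move=> i /=; rewrite inE => /orP[iK|iL]; [exact: KJ|exact: LJ].
- by move=> i; apply: measurableI; case: ifP.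
- apply/seteqP; split => w /=.
    move=> [h1 h2] i /=; rewrite inE => _; split.
      by case: ifPn => // iK; exact: h1.
    by case: ifPn => // iL; exact: h2.
  move=> h; split => i /= ij; have := h i; rewrite /= inE ij ?orbT => /(_ isT)[].
    by [].
  by [].
Qed.

(** Two cylinders over disjoint index sets intersect in a single cylinder, whose
    probability is the product over the union of the index sets. *)
Lemma independent_cylinders I J : mutually_independent P Y ->
  I `&` J = set0 -> independent_systems P (cylinders I) (cylinders J).
Proof.
move=> Yind IJ0 _ _ [K [B [KI mB ->]]] [L [C [LJ mC ->]]].
have KL0 : [disjoint K & L]%fset.
  apply/fdisjointP => i iK; apply/negP => iL.
  by have : (I `&` J) i by [split; [exact: KI|exact: LJ]]; rewrite IJ0.
have LK i : i \in L -> i \in K = false.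
  move=> iL; apply/negP => iK; by move/fdisjointP: KL0 => /(_ _ iK); rewrite iL.
pose D i := if i \in K then B i else C i.
transitivity (P (\bigcap_(i in [set` (K `|` L)%fset]) Y i @^-1` D i)).
  congr (P _); apply/seteqP; split => w /=.
    move=> [h1 h2] i /=; rewrite inE /D => /orP[iK|iL].
      by rewrite iK; exact: h1.
    by rewrite LK//; exact: h2.
  move=> h; split => i /= ij; have := h i; rewrite /= inE ij ?orbT /D.
    by move=> /(_ isT); rewrite ij.
  by move=> /(_ isT); rewrite LK.
rewrite Yind; last by move=> i; rewrite /D; case: ifP.
have KLE : perm_eq (K `|` L)%fset (enum_fset K ++ enum_fset L).
  apply: uniq_perm; first exact: fset_uniq.
    rewrite cat_uniq !fset_uniq andbT/=; apply/hasPn => i iL.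
    by apply/negP => iK; move: (LK _ iL); rewrite iK.
  by move=> i; rewrite mem_cat inE.
rewrite (perm_big _ KLE) big_cat/= !Yind//.
by congr (_ * _)%E; apply: eq_big_seq => i ij; rewrite /D ?ij ?LK.
Qed.

Lemma generated_sigma_preimage J i (B : set U) :
  J i -> measurable B -> generated_sigma J Y (Y i @^-1` B).
Proof.
move=> Ji mB; apply: sub_sigma_algebra; exists i => //; exists B => //.
by rewrite setTI.
Qed.

Lemma generated_sigma_cylinders J :
  generated_sigma J Y `<=` <<s cylinders J >>.
Proof.
apply: smallest_sub; first exact: smallest_sigma_algebra.
move=> _ [i Ji [B mB <-]]; apply: sub_sigma_algebra.
exists [fset i]%fset, (fun=> B); split => //.
  by move=> j /=; rewrite inE => /eqP ->.
apply/seteqP; split => w /=.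
  by move=> [_ Bw] j /=; rewrite inE => /eqP ->.
by move=> h; split => //; apply: h => /=; rewrite inE.
Qed.

Lemma generated_sigma_measurable J : generated_sigma J Y `<=` measurable.
Proof.
apply: smallest_sub; first exact: sigma_algebra_measurable.
by move=> _ [i Ji [B mB <-]]; exact: measurable_funP.
Qed.

Lemma independent_generated I J : mutually_independent P Y ->
  I `&` J = set0 ->
  independent_systems P (generated_sigma I Y) (generated_sigma J Y).
Proof.
move=> Yind IJ0 A B /generated_sigma_cylinders IA /generated_sigma_cylinders JB.
have mS K : <<s cylinders K >> `<=` measurable.
  apply: smallest_sub; first exact: sigma_algebra_measurable.
  exact: cylinders_measurable.
have h := independent_cylinders Yind IJ0.
have h1 := independent_systems_generated (@cylinders_measurable I)
  (@cylinders_measurable J) (@cylindersI I) (@cylindersT I) h.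
have h2 := independent_systems_generated (@cylinders_measurable J)
  (mS I) (@cylindersI J) (@cylindersT J) (independent_systemsC h1).
by rewrite setIC (h2 _ _ JB IA) muleC.
Qed.

End grouping.

(** * Variables measurable for a generated sigma-algebra *)

Section adapted.
Context (d : measure_display) (W : measurableType d) (R : realType).
Implicit Types (G : set (set W)) (Z : W -> R).

(** Measurability for [<<s G >>] is ordinary measurability on a copy of [W], so
    that the closure properties of measurable functions apply to it. *)
Definition adapted G Z : Prop :=
  measurable_fun setT (Z : g_sigma_algebraType G -> R).

Lemma adaptedP G Z : (forall S, measurable S -> <<s G >> (Z @^-1` S)) ->
  adapted G Z.
Proof. by move=> h _ S mS; rewrite setTI; exact: h. Qed.

Lemma adapted_preimage G Z S : adapted G Z -> measurable S ->
  <<s G >> (Z @^-1` S).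
Proof.
by move=> GZ mS; have := GZ measurableT S mS; rewrite setTI.
Qed.

Lemma adapted_sum G (I : eqType) (s : seq I) (Z : I -> W -> R) :
  (forall i, i \in s -> adapted G (Z i)) ->
  adapted G (fun w => \sum_(i <- s) Z i w).
Proof.
move=> GZ.
rewrite (_ : (fun w => _) = (fun w => \sum_(i <- s)
    (if i \in s then Z i w else 0))); last first.
  by apply/funext => w; apply: eq_big_seq => i ->.
by apply: measurable_sum => i; case: (boolP (i \in s)) => [/GZ|_].
Qed.

Lemma generated_setI G A B : <<s G >> A -> <<s G >> B -> <<s G >> (A `&` B).
Proof.
by move=> GA GB; apply: (@measurableI _ (g_sigma_algebraType G)).
Qed.

Lemma generated_setT G : <<s G >> setT.
Proof. exact: (@measurableT _ (g_sigma_algebraType G)). Qed.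

End adapted.

(** * The gauge of a ruin set *)

Section gauge.
Context (R : realType) (n : nat) (A : set 'rV[R]_n).
Hypothesis hA : ruin_family A.
Implicit Types (v w : 'rV[R]_n) (c u x : R).

Lemma scale_setE c v : c != 0 -> scale_set c A v <-> A (c^-1 *: v).
Proof.
move=> c0; split => [[a Aa <-]|Av]; first by rewrite scalerA mulVf// scale1r.
by exists (c^-1 *: v) => //; rewrite scalerA divff// scale1r.
Qed.

Lemma scale_set_scale c x v : c != 0 -> x != 0 ->
  scale_set x A (c *: v) <-> scale_set (x / c) A v.
Proof.
move=> c0 x0; rewrite !scale_setE ?mulf_neq0 ?invr_eq0//.
by rewrite scalerA invfM invrK.
Qed.

Lemma ruin_family_compl_convex v w c : 0 <= c <= 1 -> ~ A v -> ~ A w ->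
  ~ A (c *: v + (1 - c) *: w).
Proof.
case: hA => _ _ _ + _ => /= convA /andP[c0 c1] Av Aw.
pose p : {i01 R} := Itv01 c0 c1.
have := convA v w p; rewrite !inE => /(_ Av Aw).
exact.
Qed.

Lemma ruin_family_small : exists2 e, 0 < e & forall v, `|v| < e -> ~ A v.
Proof.
case: hA => _ _ _ _ /existsNP[B /not_implyP[/nbhs_ballP[e /= e0 eB] AB]].
exists e => // v ve Av; apply: AB; exists v; split => //; apply: eB.
by rewrite -ball_normE/= sub0r normrN.
Qed.

Lemma ruin_family_not0 : ~ A 0.
Proof. by have [e e0] := ruin_family_small; apply; rewrite normr0. Qed.

(** The complement of [A] is convex and contains the origin. *)
Lemma ruin_family_shrink v c : 1 <= c -> A v -> A (c *: v).
Proof.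
move=> c1; apply: contraPP => Acv.
have c0 : 0 < c by exact: lt_le_trans c1.
have := @ruin_family_compl_convex (c *: v) 0 c^-1 _ Acv ruin_family_not0.
rewrite scaler0 addr0 scalerA mulVf ?gt_eqF// scale1r; apply.
by rewrite invr_ge0 (ltW c0)/= invf_le1.
Qed.

Let S v := [set u | 0 < u /\ scale_set u A v].

Lemma scale_set_le x u v : 0 < x -> x <= u -> scale_set u A v ->
  scale_set x A v.
Proof.
move=> x0 xu; have u0 := lt_le_trans x0 xu.
rewrite !scale_setE ?gt_eqF// => Av.
have -> : x^-1 *: v = (u / x) *: (u^-1 *: v).
  by rewrite scalerA mulrAC divff ?mul1r// gt_eqF.
by apply: ruin_family_shrink => //; rewrite ler_pdivlMr// mul1r.
Qed.

Let S_ubound v : has_ubound (S v).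
Proof.
have [e e0 Ae] := ruin_family_small.
exists (`|v| / e) => u /= [u0]; rewrite scale_setE ?gt_eqF// => Av.
rewrite leNgt; apply/negP => uv; apply: Ae Av.
rewrite normrZ gtr0_norm ?invr_gt0// mulrC ltr_pdivrMr//.
by move: uv; rewrite ltr_pdivrMr// mulrC.
Qed.

Lemma gauge_sup_ge0 v : 0 <= gauge_sup A v.
Proof.
have [S0|/set0P[u [u0 Su]]] := eqVneq (S v) set0.
  by rewrite (_ : gauge_sup A v = sup (S v))// S0 sup0.
by apply: le_trans (ltW u0) _; apply: (ub_le_sup (S_ubound v)).
Qed.

(** The complement of [A] is star-shaped about the origin, so the levels [u] with
    [v] in [u A] form an interval starting at [0]; the interval is open because
    [A] is, which makes the inequality strict. *)
Lemma lt_gauge_sup x v : 0 < x -> x < gauge_sup A v <-> scale_set x A v.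
Proof.
move=> x0; split => [xg|Av].
  have S0 : S v !=set0.
    apply/set0P; apply/eqP => S0; move: xg.
    by rewrite (_ : gauge_sup A v = sup (S v))// S0 sup0 ltNge ltW.
  have [u [u0 Su] xu] := sup_gt S0 xg.
  exact: scale_set_le (ltW xu) Su.
move: Av; rewrite scale_setE ?gt_eqF// => Av.
have /nbhs_ballP[e /= e0 eA] : nbhs (1 : R) [set k | A (k *: (x^-1 *: v))].
  apply: scalel_continuous; rewrite scale1r.
  by case: hA => _ oA _ _ _; exact: open_nbhs_nbhs.
have m0 : 0 < Num.min e 1 by rewrite lt_min e0/=.
have me : Num.min e 1 <= e by rewrite ge_min lexx.
have m1 : Num.min e 1 <= 1 by rewrite ge_min lexx orbT.
(* [x / k] is a level above [x] whose scaled set still contains [v] *)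
pose k := 1 - Num.min e 1 / 2.
have k0 : 0 < k by rewrite /k; lra.
have k1 : k < 1 by rewrite /k; lra.
have Ak : A (k *: (x^-1 *: v)).
  apply: eA; rewrite /ball/= /k opprB addrC subrK.
  by rewrite gtr0_norm ?divr_gt0//; lra.
have : (S v) (x / k).
  split; first by rewrite divr_gt0.
  by rewrite scale_setE ?gt_eqF ?divr_gt0// invfM invrK mulrC -scalerA.
move=> /(ub_le_sup (S_ubound v)); apply: lt_le_trans.
by rewrite ltr_pdivlMr// gtr_pMr.
Qed.

(** If [v] is outside [a A] and [w] outside [b A], then [(a + b)^-1 *: (v + w)] is a
    convex combination of two points of the complement of [A]. *)
Lemma gauge_supD v w : gauge_sup A (v + w) <= gauge_sup A v + gauge_sup A w.
Proof.
rewrite leNgt; apply/negP => h.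
pose e := (gauge_sup A (v + w) - (gauge_sup A v + gauge_sup A w)) / 3.
have e0 : 0 < e by rewrite divr_gt0// subr_gt0.
pose a := gauge_sup A v + e; pose b := gauge_sup A w + e.
have a0 : 0 < a by rewrite ltr_wpDl// gauge_sup_ge0.
have b0 : 0 < b by rewrite ltr_wpDl// gauge_sup_ge0.
have ab0 : 0 < a + b by rewrite addr_gt0.
have Av : ~ A (a^-1 *: v).
  by rewrite -scale_setE ?gt_eqF// -lt_gauge_sup// => /lt_gtF; rewrite ltrDl e0.
have Aw : ~ A (b^-1 *: w).
  by rewrite -scale_setE ?gt_eqF// -lt_gauge_sup// => /lt_gtF; rewrite ltrDl e0.
have : a + b < gauge_sup A (v + w) by rewrite /a /b /e; lra.
rewrite lt_gauge_sup// scale_setE ?gt_eqF//.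
have -> : (a + b)^-1 *: (v + w) =
    (a / (a + b)) *: (a^-1 *: v) + (1 - a / (a + b)) *: (b^-1 *: w).
  have -> : 1 - a / (a + b) = b / (a + b) by field; rewrite gt_eqF.
  rewrite scalerDr !scalerA; congr (_ *: _ + _ *: _); field.
    by rewrite !gt_eqF.
  by rewrite !gt_eqF.
apply: ruin_family_compl_convex => //.
apply/andP; split; first exact: divr_ge0 (ltW a0) (ltW ab0).
by rewrite ler_pdivrMr// mul1r lerDl ltW.
Qed.

Lemma gauge_sup0 : gauge_sup A 0 = 0.
Proof.
apply/eqP; rewrite eq_le gauge_sup_ge0 andbT leNgt; apply/negP => g0.
have /lt_gauge_sup : 0 < gauge_sup A 0 / 2 by rewrite divr_gt0.
move=> /(_ 0)[+ _]; rewrite gtr_pMr// scale_setE ?gt_eqF ?divr_gt0//.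
rewrite scaler0 => /(_ _)/ruin_family_not0; apply.
by rewrite invf_lt1// ltrDl.
Qed.

Lemma gauge_supZ c v : 0 < c -> gauge_sup A (c *: v) = c * gauge_sup A v.
Proof.
move=> c0.
have key x : 0 < x -> x < gauge_sup A (c *: v) <-> x < c * gauge_sup A v.
  move=> x0; have xc0 : 0 < x / c by exact: divr_gt0.
  have h := @scale_set_scale c x v (lt0r_neq0 c0) (lt0r_neq0 x0).
  by rewrite mulrC -ltr_pdivrMr// !lt_gauge_sup.
have g0 := gauge_sup_ge0 (c *: v).
have g1 : 0 <= c * gauge_sup A v by rewrite mulr_ge0 ?gauge_sup_ge0// ltW.
apply/eqP; rewrite eq_le !leNgt; apply/andP; split; apply/negP => h.
  have /key[+ _] : 0 < (gauge_sup A (c *: v) + c * gauge_sup A v) / 2 by lra.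
  by lra.
have /key[_] : 0 < (gauge_sup A (c *: v) + c * gauge_sup A v) / 2 by lra.
by lra.
Qed.

Lemma gauge_sup_sum (I : Type) (s : seq I) (c : I -> R) (v : I -> 'rV[R]_n) :
  (forall i, 0 < c i) ->
  gauge_sup A (\sum_(i <- s) c i *: v i) <=
  \sum_(i <- s) c i * gauge_sup A (v i).
Proof.
move=> c0; elim: s => [|i s IH]; first by rewrite !big_nil gauge_sup0.
rewrite !big_cons (le_trans (gauge_supD _ _))// gauge_supZ//.
by rewrite lerD2l.
Qed.

Lemma scale_setD x v w : 0 < x -> nonneg_vec w ->
  scale_set x A v -> scale_set x A (v + w).
Proof.
move=> x0 w0; rewrite !scale_setE ?gt_eqF// scalerDr => Av.
case: hA => _ _ incr _ _; apply: incr => // j.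
by rewrite mxE mulr_ge0// invr_ge0 ltW.
Qed.

Lemma open_scale_set x : 0 < x -> open (scale_set x A).
Proof.
move=> x0; rewrite (_ : scale_set x A = ( *:%R x^-1) @^-1` A).
  apply: open_comp; last by case: hA.
  by move=> v _; exact: scaler_continuous.
by apply/seteqP; split => v /=; rewrite scale_setE ?gt_eqF.
Qed.

(** For [x >= 0] the gauge exceeds [x] exactly on the union of the open sets
    [u A] with [u > x]. *)
Lemma measurable_gauge_sup : measurable_fun setT (gauge_sup A).
Proof.
apply: (measurability _ (RGenOInfty.measurableE R)) => _ [_ [x ->] <-].
rewrite setTI; have [x0|x0] := ltP x 0.
  rewrite (_ : _ @^-1` _ = setT)//; apply/seteqP; split => v //= _.
  by rewrite in_itv/= andbT (lt_le_trans x0)// gauge_sup_ge0.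
rewrite (_ : _ @^-1` _ = \bigcup_(u in [set u | x < u]) scale_set u A).
  apply: sub_sigma_algebra; apply: bigcup_open => u /= xu.
  by apply: open_scale_set; exact: le_lt_trans xu.
apply/seteqP; split => v /=.
  rewrite in_itv/= andbT => xg; exists ((x + gauge_sup A v) / 2) => /=; first lra.
  by rewrite -lt_gauge_sup; lra.
move=> [u /= xu uv]; rewrite in_itv/= andbT (lt_trans xu)//.
by rewrite lt_gauge_sup//; exact: le_lt_trans xu.
Qed.

End gauge.

(** An open set is a countable union of boxes with rational centre and radius, so
    measurability of the coordinates is enough. *)
Lemma measurable_preimage_open (R : realType) (n : nat) (d : measure_display)
    (W : measurableType d) (V : W -> 'rV[R]_n) (O : set 'rV[R]_n) :
  (forall j, measurable_fun setT (fun w => V w 0 j)) -> open O ->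
  measurable (V @^-1` O).
Proof.
move=> mV oO.
pose box (p : 'rV[rat]_n * rat) : set 'rV[R]_n :=
  [set v | forall j, `|v 0 j - ratr (p.1 0 j)| < ratr p.2].
rewrite (_ : V @^-1` O = \bigcup_p
    (if pselect (box p `<=` O) then V @^-1` box p else set0)); last first.
  apply/seteqP; split => w /=; last first.
    by move=> [p _]; case: pselect => //= pO Vp; exact: pO.
  move=> OVw; have /nbhs_ballP[e /= e0 eO] : nbhs (V w) O.
    exact: open_nbhs_nbhs.
  have [q /[!in_itv]/= /andP[q0 qe]] : exists q : rat, ratr q \in `]0, e / 2[%R.
    by apply: rat_in_itvoo; rewrite divr_gt0.
  have /choice[c hc] j : exists c : rat, ratr c \in `]V w 0 j, V w 0 j + ratr q[%R.
    by apply: rat_in_itvoo; rewrite ltrDl.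
  exists (\row_j c j, q) => //.
  case: pselect => [_|[]] /=.
    move=> j; rewrite mxE; have := hc j; rewrite in_itv/= => /andP[h1 h2].
    by rewrite ltr_norml; apply/andP; split; lra.
  move=> v vbox; apply: eO; split => // i j; rewrite ord1 /ball/=.
  have := vbox j; rewrite mxE /=; have := hc j; rewrite in_itv/= => /andP[h1 h2].
  by rewrite !ltr_norml => /andP[h3 h4]; apply/andP; split; lra.
apply: countable_bigcupT_measurable => // p.
case: pselect => //= _.
rewrite (_ : _ @^-1` _ = \bigcap_(j in [set: 'I_n])
    [set w | `|V w 0 j - ratr (p.1 0 j)| < ratr p.2]).
  apply: fin_bigcap_measurable => // j _; apply: measurable_gt => //.
  apply: measurableT_comp; first exact: normr_measurable.
  exact: measurable_funB.
by apply/seteqP; split => w /= h j; [move=> _|]; exact: h.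
Qed.

(** * Sums of nonnegative reals *)

Section nonnegative_sums.
Context (R : realType).

Lemma le_sum_ord (f : nat -> R) m n : (forall i, 0 <= f i) -> (m <= n)%N ->
  \sum_(i < m) f i <= \sum_(i < n) f i.
Proof.
move=> f0 /subnKC <-; rewrite big_split_ord/= lerDl.
by apply: sumr_ge0 => i _; exact: (f0 (m + i)%N).
Qed.

(** The partial sums have a supremum; past an index where they come within [e]
    of it, at most [e] remains. *)
Lemma bounded_series_tail (a : nat -> R) (B e : R) : (forall n, 0 <= a n) ->
  (forall n, \sum_(i < n) a i <= B) -> 0 < e ->
  exists m, forall n, \sum_(i < n) a (m + i)%N <= e.
Proof.
move=> a0 aB e0; pose S := [set s | exists n, s = \sum_(i < n) a i].
have S0 : S !=set0 by exists (\sum_(i < 0) a i), 0%N.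
have Sb : has_ubound S by exists B => _ [n ->]; exact: aB.
have [_ [m ->] hm] := sup_adherent e0 (conj S0 Sb).
exists m => n; have : \sum_(i < m + n) a i <= sup S.
  by apply: ub_le_sup => //; exists (m + n)%N.
by rewrite big_split_ord/=; move: hm; lra.
Qed.

End nonnegative_sums.

(** * Probabilities as real numbers *)

Section real_probability.
Context (d : measure_display) (W : measurableType d) (R : realType)
  (P : probability W R).
Implicit Types (U Z : W -> R) (B D E F : set W).

(** Real-valued, so that linear arithmetic decides the estimates below. *)
Definition pr E : R := fine (P E).

Lemma prE E : measurable E -> P E = (pr E)%:E.
Proof. by move=> mE; rewrite fineK// fin_num_measure. Qed.

Lemma pr_ge0 E : 0 <= pr E.
Proof. by rewrite fine_ge0. Qed.

Lemma pr_setT : pr setT = 1.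
Proof. by rewrite /pr probability_setT. Qed.

Lemma pr_set0 : pr set0 = 0.
Proof. by rewrite /pr measure0. Qed.

Lemma le_pr E F : measurable E -> measurable F -> E `<=` F -> pr E <= pr F.
Proof. by move=> mE mF EF; rewrite -lee_fin -!prE// le_measure// inE. Qed.

Lemma pr_le1 E : measurable E -> pr E <= 1.
Proof. by move=> mE; rewrite -pr_setT le_pr. Qed.

Lemma prDI E F : measurable E -> measurable F ->
  pr E = pr (E `\` F) + pr (E `&` F).
Proof.
move=> mE mF; apply: EFin_inj; rewrite EFinD -!prE//.
- exact: measureDI.
- exact: measurableI.
- exact: measurableD.
Qed.

Lemma prU E F : measurable E -> measurable F ->
  pr (E `|` F) = pr E + pr F - pr (E `&` F).
Proof.
move=> mE mF; have mEF := measurableU _ _ mE mF.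
rewrite (prDI mEF mE) (prDI mF mE) setDUl setDv set0U.
rewrite setUK [F `&` E]setIC; lra.
Qed.

Lemma prU_le E F : measurable E -> measurable F ->
  pr (E `|` F) <= pr E + pr F.
Proof. by move=> mE mF; rewrite prU// gerBl pr_ge0. Qed.

Lemma prC E : measurable E -> pr (~` E) = 1 - pr E.
Proof.
by move=> mE; have := prDI measurableT mE; rewrite setTD setTI pr_setT; lra.
Qed.

Lemma measurable_bigU (E : nat -> set W) m :
  (forall i, (i < m)%N -> measurable (E i)) -> measurable (\bigcup_(i < m) E i).
Proof. by move=> mE; apply: fin_bigcup_measurable => // i; exact: mE. Qed.

Lemma bigcup_ltS (E : nat -> set W) m :
  \bigcup_(i < m.+1) E i = (\bigcup_(i < m) E i) `|` E m.
Proof.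
apply/seteqP; split => w /=.
  move=> [i /=]; rewrite ltnS leq_eqVlt => /orP[/eqP ->|im] Eiw; first by right.
  by left; exists i.
by move=> [[i /= im Ew]|Ew]; [exists i => //=; exact: ltnW|exists m => /=].
Qed.

Lemma pr_bigcup_le (E : nat -> set W) m :
  (forall i, (i < m)%N -> measurable (E i)) ->
  pr (\bigcup_(i < m) E i) <= \sum_(i < m) pr (E i).
Proof.
elim: m => [_|m IH mE]; first by rewrite big_ord0 bigcup_mkord big_ord0 pr_set0.
have mE' i : (i < m)%N -> measurable (E i) by move=> im; apply: mE; exact: ltnW.
rewrite bigcup_ltS big_ord_recr/=.
rewrite (le_trans (prU_le (measurable_bigU mE') _))//; first exact: mE.
by rewrite lerD2r IH.
Qed.

Lemma pr_disjoint_sum (E : nat -> set W) F m :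
  (forall i, (i < m)%N -> measurable (E i)) -> measurable F ->
  (forall i j, (i < j < m)%N -> E i `&` E j = set0) ->
  (forall i, (i < m)%N -> E i `<=` F) ->
  \sum_(i < m) pr (E i) <= pr F.
Proof.
elim: m F => [F _ _ _ _|m IH F mE mF dE EF]; first by rewrite big_ord0 pr_ge0.
have mEm : measurable (E m) by exact: mE.
rewrite big_ord_recr/= (prDI mF mEm) setIidr; last exact: EF.
rewrite lerD2r; apply: IH => [i im||i j /andP[ij jm]|i im w Ew].
- by apply: mE; exact: ltnW.
- exact: measurableD.
- by apply: dE; rewrite ij ltnW.
- split; first by apply: EF Ew; exact: ltnW.
  move=> Emw; have : (E i `&` E m) w by [].
  by rewrite dE ?im/=.
Qed.

Lemma pr_gt_le U B Z D Z' D' (k : R) :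
  measurable_fun setT U -> measurable_fun setT Z -> measurable_fun setT Z' ->
  measurable B -> measurable D -> measurable D' ->
  indep_on P U B Z D -> indep_on P U B Z' D' -> 0 <= k ->
  (forall w, B w -> pr ([set v | U w < Z v] `&` D) <=
                    k * pr ([set v | U w < Z' v] `&` D')) ->
  pr ([set w | U w < Z w] `&` (B `&` D)) <=
  k * pr ([set w | U w < Z' w] `&` (B `&` D')).
Proof.
move=> mU mZ mZ' mB mD mD' UZ UZ' k0 cmp.
have mgt V (mV : measurable_fun setT V) E (mE : measurable E) w :
    measurable ([set v | U w < V v] `&` E).
  by apply: measurableI => //; exact: measurable_gt.
have mgt' V (mV : measurable_fun setT V) E (mE : measurable E) :
    measurable ([set w | U w < V w] `&` (B `&` E)).
  by apply: measurableI; [exact: measurable_gt|exact: measurableI].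
rewrite -lee_fin EFinM -!prE; [|exact: mgt'|exact: mgt'].
apply: indep_on_gt_le => // w Bw.
by rewrite !prE ?lee_fin; [exact: cmp|exact: mgt|exact: mgt].
Qed.

Lemma indep_on_pr U B Z D S S' : indep_on P U B Z D ->
  measurable_fun setT U -> measurable_fun setT Z ->
  measurable B -> measurable D -> measurable S -> measurable S' ->
  pr ((U @^-1` S `&` B) `&` (Z @^-1` S' `&` D)) =
  pr (U @^-1` S `&` B) * pr (Z @^-1` S' `&` D).
Proof.
move=> UZ mU mZ mB mD mS mS'.
have h1 : measurable (U @^-1` S `&` B).
  by apply: measurableI => //; exact: measurable_preimage.
have h2 : measurable (Z @^-1` S' `&` D).
  by apply: measurableI => //; exact: measurable_preimage.
by rewrite /pr UZ// fineM// fin_num_measure.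
Qed.

(** Continuity from above along the events [n < Z]. *)
Lemma pr_gt_cvg0 Z (e : R) : measurable_fun setT Z -> 0 < e ->
  exists2 K, 0 <= K & forall x, K <= x -> pr [set w | x < Z w] <= e.
Proof.
move=> mZ e0; pose E n := [set w | n%:R < Z w].
have mE n : measurable (E n) by exact: measurable_gt.
have E0 : \bigcap_n E n = set0.
  apply/seteqP; split => w //= h.
  have := h (Num.bound `|Z w|) I; rewrite /E/= ltNge => /negP; apply.
  by rewrite (le_trans (ler_norm _))// ltW// archi_boundP.
have := @nonincreasing_cvg_mu _ _ _ P E _ mE _ _.
rewrite E0 measure0 => h.
have {}h : P \o E @ \oo --> 0%E.
  apply: h; first by rewrite ltey_eq fin_num_measure.
    exact: measurable0.
  move=> i j ij; apply/subsetPset => w; rewrite /E/=; apply: le_lt_trans.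
  by rewrite ler_nat.
have : \forall n \near \oo, pr (E n) < e.
  have /fine_cvgP[_ {}h] := h.
  exact: (cvgr_lt _ h).
move=> [n _ /(_ n (leqnn n)) En].
exists n%:R => // x nx; apply: le_trans (ltW En).
by apply: le_pr => //; [exact: measurable_gt|move=> w; exact: le_lt_trans].
Qed.

(** Conditioning on [U] allows replacing [Z] by [Z']; what is then integrated
    depends on [U] alone, so that [U] may be replaced by [U']. *)
Lemma indep_sum_law U Z U' Z' S :
  measurable_fun setT U -> measurable_fun setT Z ->
  measurable_fun setT U' -> measurable_fun setT Z' ->
  indep_on P U setT Z setT -> indep_on P U' setT Z' setT ->
  (forall B : set R, measurable B -> P (U @^-1` B) = P (U' @^-1` B)) ->
  (forall B : set R, measurable B -> P (Z @^-1` B) = P (Z' @^-1` B)) ->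
  measurable S ->
  P [set w | S (U w + Z w)] = P [set w | S (U' w + Z' w)].
Proof.
move=> mU mZ mU' mZ' UZ UZ' UU' ZZ' mS.
pose C := [set x : R * R | S (x.1 + x.2)].
have mC : measurable C.
  by rewrite -[C]setTI; apply: (@measurable_funD _ _ _ _ fst snd).
have := indep_on_section mU mZ measurableT measurableT mC UZ.
have := indep_on_section mU' mZ' measurableT measurableT mC UZ'.
rewrite !setIT /C/= => -> ->.
have mS' u : measurable [set z : R | S (u + z)].
  rewrite -[X in measurable X]setTI.
  exact: (@measurable_funD _ _ _ _ (cst u) id).
transitivity (\int[P]_w P [set v | S ((U w + Z' v)%R)])%E.
  by apply: eq_integral => w _; rewrite setIT; exact: (ZZ' _ (mS' (U w))).
have mf : measurable_fun setT (fun u : R => P [set v | S (u + Z' v)]).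
  have := @measurable_fun_xsection _ _ _ _ R (law_on P mZ' measurableT) _ mC.
  congr measurable_fun; apply/funext => u /=; rewrite /law_on setIT.
  by congr (P _); apply/seteqP; split => v /=; rewrite /xsection/= inE.
have := ge0_integral_law_on P mU measurableT mf (fun=> measure_ge0 P _).
have := ge0_integral_law_on P mU' measurableT mf (fun=> measure_ge0 P _).
move=> e1 e2; rewrite -e2.
transitivity (\int[law_on P mU' measurableT]_u P [set v | S (u + Z' v)%R])%E.
  by apply: eq_measure_integral => B mB _; rewrite /= /law_on !setIT UU'.
by rewrite e1; apply: eq_integral => w _; rewrite setIT.
Qed.

Lemma pr_bigcup_series_le (E : nat -> set W) (c : R) :
  (forall i, measurable (E i)) -> (forall n, \sum_(i < n) pr (E i) <= c) ->
  pr (\bigcup_i E i) <= c.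
Proof.
move=> mE hc; have mU : measurable (\bigcup_i E i) by exact: bigcupT_measurable.
rewrite -lee_fin -prE//.
have := @measure_sigma_subadditive _ _ _ P _ _ mE mU (@subset_refl _ _).
move=> /le_trans; apply.
apply: lime_le; first exact: is_cvg_nneseries.
apply: nearW => n; rewrite big_mkord.
rewrite (eq_bigr (fun i : 'I_n => (pr (E i))%:E)) => [|i _]; last exact: prE.
rewrite sumEFin lee_fin; exact: hc.
Qed.

(** Removing from [E k] the later events [E (k + l).+1] makes the events
    disjoint, at the price of the pairwise intersections only. *)
Lemma pr_sum_le_overlap (E : nat -> set W) F n (c : R) :
  (forall i, measurable (E i)) -> measurable F -> (forall i, E i `<=` F) ->
  (forall k, \sum_(l < n) pr (E k `&` E (k + l).+1) <= c * pr (E k)) ->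
  (1 - c) * \sum_(k < n) pr (E k) <= pr F.
Proof.
move=> mE mF EF hc.
pose later k := \bigcup_(l in [set l | l < n]%N) E (k + l).+1.
have mlater k : measurable (later k).
  by apply: (@measurable_bigU (fun l => E (k + l).+1)).
have mD k : measurable (E k `\` later k) by exact: measurableD.
have dis i j : (i < j < n)%N -> (E i `\` later i) `&` (E j `\` later j) = set0.
  move=> /andP[ij jn]; apply/seteqP; split => w //= [[_ h] [Ej _]]; apply: h.
  exists (j - i.+1)%N => /=; first by rewrite (leq_ltn_trans _ jn)// leq_subr.
  by rewrite -addSn subnKC.
apply: le_trans (pr_disjoint_sum (fun i _ => mD i) mF dis _); last first.
  by move=> i _ w [/EF].
rewrite mulr_sumr; apply: ler_sum => k _.
have := prDI (mE k) (mlater k).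
have : pr (E k `&` later k) <= \sum_(l < n) pr (E k `&` E (k + l).+1).
  rewrite setI_bigcupr.
  apply: (@pr_bigcup_le (fun l => E k `&` E (k + l).+1)) => i _.
  exact: measurableI.
by have := hc k; lra.
Qed.

End real_probability.

(** * Independence of functions of disjoint blocks *)

Section generators.
Context (d d' : measure_display) (W : measurableType d)
  (U : measurableType d') (R : realType) (P : probability W R).
Variable Y : nat -> {mfun W >-> U}.

(** [generated_sigma J Y] is [<<s generators J >>]; the named system serves as
    parameter of [adapted]. *)
Definition generators (J : set nat) : set (set W) :=
  \bigcup_(i in J) preimage_set_system setT (Y i) measurable.

Lemma generators_adapted (J : set nat) i (f : U -> R) : J i ->
  measurable_fun setT f -> adapted (generators J) (f \o Y i).
Proof.
move=> Ji mf; apply: adaptedP => S mS; rewrite comp_preimage.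
by apply: generated_sigma_preimage => //; exact: measurable_preimage.
Qed.

Lemma indep_on_disjoint (I J : set nat) (V Z : W -> R) (B D : set W) :
  mutually_independent P Y -> I `&` J = set0 ->
  adapted (generators I) V -> adapted (generators J) Z ->
  generated_sigma I Y B -> generated_sigma J Y D -> indep_on P V B Z D.
Proof.
move=> Yind IJ0 IV JZ IB JD.
apply: (indep_on_systems (independent_systemsC (independent_generated Yind IJ0))).
  by move=> S mS; apply: generated_setI => //; exact: adapted_preimage.
by move=> S mS; apply: generated_setI => //; exact: adapted_preimage.
Qed.

Lemma adapted_measurable_fun (J : set nat) (Z : W -> R) :
  adapted (generators J) Z -> measurable_fun setT Z.
Proof.
move=> JZ _ S mS; rewrite setTI; apply: (@generated_sigma_measurable _ _ _ _ Y J).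
exact: adapted_preimage.
Qed.

End generators.

(** * Sums of subexponential claims *)

Section subexponential_sums.
Context (d : measure_display) (W : measurableType d) (R : realType)
  (P : probability W R).
Variable Y : nat -> {mfun W >-> R}.
Hypotheses (Y_ge0 : forall i w, 0 <= Y i w) (Y_iid : iid P Y).
Variable V : {measure set R -> \bar R}.
Hypothesis Y_law : forall S : set R, measurable S -> P (Y 0%N @^-1` S) = V S.
Hypothesis V_subexp : subexponential V.

Local Notation pr := (pr P).
Let Fb := tail V.
Let psum k w := \sum_(i < k) Y i w.

Let mY i : measurable_fun setT (Y i).
Proof. exact: measurable_funP. Qed.

Let mpsum k : measurable_fun setT (psum k).
Proof. by apply: measurable_sum => i; exact: mY. Qed.

Lemma iid_law i (S : set R) : measurable S -> P (Y i @^-1` S) = V S.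
Proof. by move=> mS; rewrite -Y_law//; exact: (Y_iid.2 i S mS). Qed.

Lemma pr_gt_tail i x : pr [set w | x < Y i w] = Fb x.
Proof.
rewrite /pr /Fb /tail -(@iid_law i)//; congr (fine (P _)).
by apply/seteqP; split => w /=; rewrite in_itv/= andbT.
Qed.

Lemma adapted_coordinate (J : set nat) i : J i -> adapted (generators Y J) (Y i).
Proof. by move=> Ji; apply: adaptedP => S mS; exact: generated_sigma_preimage. Qed.

Lemma adapted_psum (J : set nat) (k : nat) :
  (forall i, (i < k)%N -> J i) -> adapted (generators Y J) (psum k).
Proof.
move=> kJ; rewrite /psum (_ : (fun w => _) = fun w =>
    \sum_(i <- index_enum 'I_k) Y i w)//.
by apply: adapted_sum => i _; apply: adapted_coordinate; exact: kJ.
Qed.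

Lemma indep_Y_psum i k : (k <= i)%N -> indep_on P (Y i) setT (psum k) setT.
Proof.
move=> ki; apply: (@indep_on_disjoint _ _ _ _ _ P Y [set i] [set j | j < k]%N).
- exact: Y_iid.1.
- by apply/seteqP; split => j //= [->]; rewrite ltnNge ki.
- exact: adapted_coordinate.
- exact: adapted_psum.
- exact: generated_setT.
- exact: generated_setT.
Qed.

Lemma indep_Y_Y i j : i != j -> indep_on P (Y i) setT (Y j) setT.
Proof.
move=> ij; apply: (@indep_on_disjoint _ _ _ _ _ P Y [set i] [set j]).
- exact: Y_iid.1.
- by apply/seteqP; split => l //= [-> ji]; rewrite ji eqxx in ij.
- exact: adapted_coordinate.
- exact: adapted_coordinate.
- exact: generated_setT.
- exact: generated_setT.
Qed.

(** Both sides are built by adding one claim independent of the preceding ones. *)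
Lemma convolution_power_law k (S : set R) : measurable S ->
  convolution_power V k S = P [set w | S (psum k w)].
Proof.
elim: k S => [|k IH] S mS.
  rewrite /convolution_power/= diracE; have [S0|S0] := boolP (0 \in S).
    rewrite (_ : [set w | _] = setT) ?probability_setT//.
    by apply/seteqP; split => w //= _; rewrite /psum big_ord0; exact: set_mem.
  rewrite (_ : [set w | _] = set0) ?measure0//.
  apply/seteqP; split => w //=; rewrite /psum big_ord0 => /mem_set.
  by apply/negP.
have mS' u : measurable [set z : R | S (u + z)].
  rewrite -[X in measurable X]setTI.
  exact: (@measurable_funD _ _ _ _ (cst u) id).
pose C := [set x : R * R | S (x.1 + x.2)].
have mC : measurable C.
  by rewrite -[C]setTI; apply: (@measurable_funD _ _ _ _ fst snd).
have := indep_on_section (mY k) (mpsum k) measurableT measurableT mC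
  (indep_Y_psum (leqnn k)).
rewrite !setIT /C/= => h.
rewrite (_ : [set w | S (psum k.+1 w)] = [set w | S (Y k w + psum k w)]);
  last by apply/seteqP; split => w /=; rewrite /psum big_ord_recr/= addrC.
rewrite h /convolution.
transitivity (\int[V]_x P [set v | S (x + psum k v)%R])%E.
  by apply: eq_integral => u _; exact: IH.
have mf : measurable_fun setT (fun u : R => P [set v | S (u + psum k v)%R]).
  have := @measurable_fun_xsection _ _ _ _ R (law_on P (mpsum k) measurableT) _ mC.
  congr measurable_fun; apply/funext => u /=; rewrite /law_on setIT.
  by congr (P _); apply/seteqP; split => v /=; rewrite /xsection/= inE.
have := ge0_integral_law_on P (mY k) measurableT mf (fun=> measure_ge0 P _).
move=> e; transitivity (\int[law_on P (mY k) measurableT]_u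
    P [set v | S (u + psum k v)%R])%E.
  by apply: eq_measure_integral => B mB _; rewrite /= /law_on setIT iid_law.
by rewrite e; apply: eq_integral => w _; rewrite setIT.
Qed.

Lemma tail_gt0 x : 0 < Fb x.
Proof. exact: V_subexp.1. Qed.

Lemma tail_le1 x : Fb x <= 1.
Proof. by rewrite -(pr_gt_tail 0) pr_le1//; exact: measurable_gt. Qed.

Lemma le_tail x y : x <= y -> Fb y <= Fb x.
Proof.
move=> xy; rewrite -!(pr_gt_tail 0).
apply: le_pr; [exact: measurable_gt|exact: measurable_gt|].
by move=> w /=; exact: le_lt_trans.
Qed.

(** The upper half of subexponentiality, extended to [k <= 1], where the law of
    the sum is explicit. The matching lower bounds come from the disjoint events
    exhibited in the proofs below. *)
Lemma pr_psum_le_asymp k (e : R) : 0 < e -> exists2 x0, 0 <= x0 &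
  forall x, x0 <= x -> pr [set w | x < psum k w] <= (k%:R + e) * Fb x.
Proof.
move=> e0; have [k2|] := leqP 2 k; last first.
  case: k => [_|[_|//]].
    exists 0 => // x x0; rewrite (_ : [set w | _] = set0).
      by rewrite pr_set0 add0r mulr_ge0 ?ltW ?tail_gt0.
    apply/seteqP; split => w //=.
    by rewrite /psum big_ord0 ltNge x0.
  exists 0 => // x x0; rewrite (_ : [set w | _] = [set w | x < Y 0 w]).
    by rewrite pr_gt_tail mulrDl mul1r lerDl mulr_ge0 ?ltW ?tail_gt0.
  by apply/seteqP; split => w /=; rewrite /psum big_ord1.
have := V_subexp.2 k k2.
move=> /cvgr_lt /(_ (k%:R + e)); rewrite ltrDl => /(_ e0).
move=> [M [_ MP]]; exists (Num.max 0 (M + 1)).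
  by rewrite le_max lexx.
move=> x; rewrite ge_max => /andP[x0 Mx].
have := MP x; rewrite (lt_le_trans _ Mx) ?ltrDl// => /(_ isT).
rewrite ltr_pdivrMr ?tail_gt0// => /ltW; apply: le_trans.
rewrite /tail convolution_power_law// /pr le_eqVlt; apply/orP; left.
apply/eqP; congr (fine (P _)); apply/seteqP.
by split => w /=; rewrite in_itv/= andbT.
Qed.

Lemma tail_cvg0 (e : R) : 0 < e -> exists2 K, 0 <= K &
  forall x, K <= x -> Fb x <= e.
Proof.
move=> e0; have [K K0 h] := pr_gt_cvg0 P (mY 0) e0.
by exists K => // x /h; rewrite pr_gt_tail.
Qed.

Lemma pr_indep_pair i j (S S' : set R) : i != j ->
  measurable S -> measurable S' ->
  pr (Y i @^-1` S `&` Y j @^-1` S') = pr (Y i @^-1` S) * pr (Y j @^-1` S').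
Proof.
move=> ij mS mS'; have := indep_on_pr (indep_Y_Y ij) (mY i) (mY j)
  measurableT measurableT mS mS'.
by rewrite !setIT.
Qed.

(** Long tails: the sum of two claims exceeds [x] on the disjoint events
    [Y0 > x], [Y0 <= h, Y1 > x] and [h < Y0 <= x, Y1 > x - h]; since the total
    mass is at most about [2 Fb x], the tail at [x - h] cannot be much larger
    than the tail at [x]. *)
Lemma tail_long (h e : R) : 0 <= h -> 0 < e -> exists2 x0, 0 <= x0 &
  forall x, x0 <= x -> Fb (x - h) <= (1 + e) * Fb x.
Proof.
(* [c] solves [Fb h + c = (1 + e) * (Fb h - c)] *)
move=> h0 e0; pose c := e * Fb h / (2 + e).
have Fh0 := tail_gt0 h.
have e2 : 0 < 2 + e by rewrite addr_gt0.
have c0 : 0 < c by rewrite /c divr_gt0// mulr_gt0.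
have [x1 x10 hx1] := pr_psum_le_asymp 2 c0.
have [x2 x20 hx2] := tail_cvg0 c0.
exists (Num.max h (Num.max x1 x2)); first by rewrite le_max h0.
move=> x; rewrite !ge_max => /and3P[hx x1x x2x].
have {hx1} := hx1 _ x1x; have {hx2} := hx2 _ x2x => Fxc.
set E := [set w | x < psum 2 w] => hE.
pose E1 := Y 0 @^-1` `]x, +oo[ `&` Y 1 @^-1` setT.
pose E2 := Y 0 @^-1` `]-oo, h] `&` Y 1 @^-1` `]x, +oo[.
pose E3 := Y 0 @^-1` `]h, x] `&` Y 1 @^-1` `](x - h), +oo[.
pose Es i := if i is i.+1 then if i is 0%N then E2 else E3 else E1.
have prY i (a : R) : pr (Y i @^-1` `]a, +oo[) = Fb a.
  by rewrite -(pr_gt_tail i); congr (fine (P _)); apply/seteqP; split => w /=;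
    rewrite in_itv/= andbT.
have pE1 : pr E1 = Fb x.
  by rewrite pr_indep_pair// preimage_setT pr_setT mulr1 prY.
have pE2 : pr E2 = (1 - Fb h) * Fb x.
  rewrite pr_indep_pair// prY; congr (_ * _); rewrite -(prY 0%N) -prC.
    congr (fine (P _)); apply/seteqP; split => w /=; rewrite !in_itv/= andbT.
      by move=> /le_gtF ->.
    by move/negP; rewrite -leNgt.
  exact: measurable_preimage.
have pE3 : pr E3 = (Fb h - Fb x) * Fb (x - h).
  rewrite pr_indep_pair// prY; congr (_ * _).
  rewrite -!(prY 0%N) (@prDI _ _ _ _ (Y 0%N @^-1` `]h, +oo[) (Y 0%N @^-1` `]x, +oo[));
    [|exact: measurable_preimage|exact: measurable_preimage].
  rewrite [X in _ = _ + pr X - _](_ : _ = Y 0%N @^-1` `]x, +oo[) ?addrK.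
    congr (fine (P _)); apply/seteqP; split => w /=; rewrite !in_itv/= !andbT.
      by move=> /andP[-> /le_gtF ->].
    by move=> [-> /negP]; rewrite -leNgt.
  apply/seteqP; split => w /=; rewrite !in_itv/= !andbT; first by case.
  by move=> xY; split => //; exact: le_lt_trans xY.
have mEs i : measurable (Es i).
  by case: i => [|[|i]]; apply: measurableI; exact: measurable_preimage.
have disE i j : (i < j < 3)%N -> Es i `&` Es j = set0.
  move=> /andP[]; case: j => [|[|[|j]]]//; case: i => [|[|i]]// _ _;
    apply/seteqP; split=> w //=;
    rewrite /E1 /E2 /E3/= !in_itv/= ?andbT => -[[+ _] [+ _]]; first by lra.
  - by move=> xY /andP[_]; lra.
  - by move=> Yh /andP[hY _]; lra.
have subE i : (i < 3)%N -> Es i `<=` E.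
  case: i => [|[|[|i]]] //= _ w;
    rewrite /E1 /E2 /E3 /E/= ?in_itv/= ?andbT /psum
    !big_ord_recr big_ord0 /= add0r => -[].
  - by have := Y_ge0 1 w; lra.
  - by have := Y_ge0 0 w; lra.
  - by move=> /andP[+ _]; lra.
have mE : measurable E by exact: measurable_gt.
have := pr_disjoint_sum P (fun i _ => mEs i) mE disE subE.
rewrite !big_ord_recr big_ord0 /= pE1 pE2 pE3 add0r => /le_trans/(_ hE) key.
have F1 := tail_le1 (x - h).
have F2 := tail_gt0 (x - h).
have F3 := tail_gt0 x.
have : (Fb h - c) * Fb (x - h) <= (Fb h + c) * Fb x by nra.
have -> : Fb h + c = (1 + e) * (Fb h - c) by rewrite /c; field; rewrite gt_eqF.
have Fhc : 0 < Fb h - c.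
  by rewrite subr_gt0 /c ltr_pdivrMr// mulrC ltr_pM2l//; lra.
by rewrite (mulrAC (1 + e)) [leRHS]mulrC ler_pM2l.
Qed.

Definition other_sum (m i : nat) w := \sum_(j < m | j != i :> nat) Y j w.

(** Whichever claim is set aside, the others still exceed [K] in total. *)
Definition no_dominant_claim m (K : R) : set W :=
  [set w | forall i, (i < m)%N -> K < other_sum m i w].

Lemma adapted_other_sum (J : set nat) (m i : nat) :
  (forall j, (j < m)%N -> j != i -> J j) ->
  adapted (generators Y J) (other_sum m i).
Proof.
move=> mJ; rewrite /other_sum (_ : (fun w => _) = fun w => \sum_(j <-
    [seq j : 'I_m <- index_enum 'I_m | j != i :> nat]) Y (nat_of_ord j) w).
  by apply: adapted_sum => j; rewrite mem_filter => /andP[ji _];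
    apply: adapted_coordinate; exact: mJ.
by apply/funext => w; rewrite big_filter.
Qed.

Lemma no_dominant_claim_generated m K :
  generated_sigma setT Y (no_dominant_claim m K).
Proof.
rewrite (_ : no_dominant_claim m K =
    \bigcap_(i in [set i | (i < m)%N]) [set w | K < other_sum m i w]) //.
apply: (@fin_bigcap_measurable _ (g_sigma_algebraType (generators Y setT))).
  exact: finite_II.
move=> i _; apply: (@measurable_gt _ _
  (g_sigma_algebraType (generators Y setT)) (other_sum m i) (cst K)) => //.
exact: adapted_other_sum.
Qed.

Lemma measurable_no_dominant_claim m K : measurable (no_dominant_claim m K).
Proof. exact: generated_sigma_measurable (@no_dominant_claim_generated m K). Qed.

Let measurable_other_sum m i : measurable_fun setT (other_sum m i).
Proof.
exact: adapted_measurable_fun (@adapted_other_sum setT m i (fun _ _ _ => I)).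
Qed.

Lemma other_sum_le m i w : other_sum m i w <= psum m w.
Proof.
rewrite /other_sum /psum big_mkcond/=; apply: ler_sum => j _.
by case: ifP => _ //; exact: Y_ge0.
Qed.

Lemma psum_other m i w : (i < m)%N -> psum m w = Y i w + other_sum m i w.
Proof. by move=> im; rewrite /psum (bigD1 (Ordinal im))//=. Qed.

Lemma other_sum_ge m i j w : (j < m)%N -> j != i -> Y j w <= other_sum m i w.
Proof.
move=> jm ji; rewrite /other_sum (bigD1 (Ordinal jm))//= lerDl.
by apply: sumr_ge0 => k _; exact: Y_ge0.
Qed.

Lemma other_sum_ge0 m i w : 0 <= other_sum m i w.
Proof. by apply: sumr_ge0 => k _; exact: Y_ge0. Qed.

(** Single big jump: for each [i] the event that claim [i] alone exceeds [u]
    while the others sum to at most [K] has probability nearly [Fb u]; these [m]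
    disjoint events exhaust the mass [m * Fb u] of [psum m > u]. *)
Lemma single_big_jump m (e : R) : 0 < e -> exists2 K, 0 <= K &
  exists2 x0, 0 <= x0 & forall u, x0 <= u ->
  pr ([set w | u < psum m w] `&` no_dominant_claim m K) <= e * Fb u.
Proof.
move=> e0; have e2 : 0 < e / 2 by rewrite divr_gt0.
have [c c0 hm] : exists2 c, 0 < c & m%:R * c <= e / 2.
  have m0 : (0 : R) < m.+1%:R by rewrite ltr0n.
  exists (e / 2 / m.+1%:R); first exact: divr_gt0.
  by rewrite mulrA ler_pdivrMr// mulrC ler_wpM2l ?ler_nat// ltW.
have [K K0 hK] := pr_gt_cvg0 P (mpsum m) c0.
have [x1 x10 hx1] := pr_psum_le_asymp m e2.
exists K => //; exists (Num.max K x1); first by rewrite le_max K0.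
move=> u; rewrite ge_max => /andP[Ku x1u]; have {hx1} := hx1 _ x1u.
set F := [set w | u < psum m w] => hF.
pose E i := [set w | u < Y i w] `&` [set w | other_sum m i w <= K].
have mF : measurable F by exact: measurable_gt.
have mN := measurable_no_dominant_claim m K.
have mle i : measurable [set w | other_sum m i w <= K].
  exact: (@measurable_le _ _ _ (other_sum m i) (cst K)).
have mE i : measurable (E i).
  by apply: measurableI => //; exact: (@measurable_gt _ _ _ (Y i) (cst u)).
have pE i : (i < m)%N -> (1 - c) * Fb u <= pr (E i).
  move=> im.
  have ind : indep_on P (Y i) setT (other_sum m i) setT.
    apply: (@indep_on_disjoint _ _ _ _ _ P Y [set i] (~` [set i])).
    - exact: Y_iid.1.
    - exact: setICr.
    - exact: adapted_coordinate.
    - by apply: adapted_other_sum => j _ /eqP ji.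
    - exact: generated_setT.
    - exact: generated_setT.
  have := @indep_on_pr _ _ _ _ _ _ _ _ `]u, +oo[ `]-oo, K] ind (mY i)
    (measurable_other_sum m i) measurableT measurableT
    (measurable_itv _) (measurable_itv _).
  rewrite !setIT.
  rewrite (_ : _ @^-1` `]u, +oo[ = [set w | u < Y i w]); last first.
    by apply/seteqP; split => w /=; rewrite in_itv/= andbT.
  rewrite (_ : _ @^-1` `]-oo, K] = [set w | other_sum m i w <= K]); last first.
    by apply/seteqP; split => w /=; rewrite in_itv/=.
  rewrite -/(E i) pr_gt_tail => ->; rewrite mulrC ler_wpM2l//.
    exact: ltW (tail_gt0 u).
  have := hK K (lexx _); have := prC P (mle i).
  have : pr (~` [set w | other_sum m i w <= K]) <= pr [set w | K < psum m w].
    apply: le_pr; [exact: measurableC|exact: measurable_gt|].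
    by move=> w /= /negP; rewrite -ltNge => /lt_le_trans; apply; exact: other_sum_le.
  lra.
have disE i j : (i < j < m)%N -> E i `&` E j = set0.
  move=> /andP[ij jm]; apply/seteqP; split=> w //= -[[_ oi] [uj _]].
  have := @other_sum_ge m i j w jm; rewrite gtn_eqF// => /(_ isT).
  by move: oi uj => /=; lra.
have subE i : (i < m)%N -> E i `<=` F `\` (F `&` no_dominant_claim m K).
  move=> im w [/= uY oK]; split.
    by rewrite /F/= (psum_other w im) (lt_le_trans uY)// lerDl other_sum_ge0.
  by move=> [_ /(_ i im)]; rewrite ltNge oK.
have mFN : measurable (F `&` no_dominant_claim m K) by exact: measurableI.
have h3 := pr_disjoint_sum P (fun i _ => mE i) (measurableD mF mFN) disE subE.
have h1 := prDI P mF mFN; rewrite setIA setIid in h1.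
have h2 : \sum_(i < m) (1 - c) * Fb u <= \sum_(i < m) pr (E i).
  by apply: ler_sum => i _; exact: pE.
rewrite sumr_const card_ord -mulr_natl in h2.
have h4 : m%:R * c * Fb u <= e / 2 * Fb u by rewrite ler_pM2r// tail_gt0.
by move: hF h1 h2 h3 h4; rewrite mulrBl mul1r mulrBr mulrA mulrDl; lra.
Qed.

(** Kesten's bound. Conditioning on the last claim [Y k], the first [k] claims
    are compared with the single claim [Y k.+1]; what remains is the sum of two
    claims, whose tail beyond that of one claim is at most [(1 + e) * Fb x] for
    large [x]; the constant [M] of the proof takes care of the other [x]. *)
Lemma kesten_bound (e : R) : 0 < e -> exists2 C, 0 < C &
  forall k x, 0 <= x -> pr [set w | x < psum k w] <= C * (1 + e) ^+ k * Fb x.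
Proof.
move=> e0; have [x0 x00 hx0] := pr_psum_le_asymp 2 e0.
have F0 := tail_gt0 x0.
pose M := 1 + (Fb x0)^-1.
have M0 : 0 < M by rewrite /M addr_gt0 ?invr_gt0.
have C0 : 0 < M / e by rewrite divr_gt0.
have e1 : 1 <= 1 + e by rewrite lerDl ltW.
exists (M / e) => //.
suff H k x : 0 <= x ->
    pr [set w | x < psum k w] <= M / e * ((1 + e) ^+ k - 1) * Fb x.
  move=> k x /H/le_trans; apply; rewrite ler_pM2r ?tail_gt0// ler_pM2l//.
  by rewrite gerBl.
elim: k x => [|k IH] x x0'.
  rewrite (_ : [set w | _] = set0) ?pr_set0 ?expr0 ?subrr ?mulr0 ?mul0r//.
  by apply/seteqP; split => w //=; rewrite /psum big_ord0 ltNge x0'.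
have ek1 : 1 <= (1 + e) ^+ k by rewrite exprn_ege1.
have ek : M / e * ((1 + e) ^+ k.+1 - 1) =
    M + (1 + e) * (M / e * ((1 + e) ^+ k - 1)).
  by rewrite exprS; field; rewrite gt_eqF.
set c := M / e * ((1 + e) ^+ k - 1) in IH ek *.
have c0 : 0 <= c by rewrite mulr_ge0 ?subr_ge0// ltW.
rewrite ek; have [xx0|x0x] := ltP x x0.
  apply: (@le_trans _ _ 1); first by apply: pr_le1; exact: measurable_gt.
  have Fx : Fb x0 <= Fb x by apply: le_tail; exact: ltW.
  have : 1 <= (Fb x0)^-1 * Fb x by rewrite mulrC ler_pdivlMr// mul1r.
  have := tail_gt0 x; have : 0 <= (1 + e) * c * Fb x.
    by apply: mulr_ge0; [apply: mulr_ge0 => //; lra|exact: ltW (tail_gt0 x)].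
  by rewrite /M !mulrDl mul1r; lra.
pose B := [set w | Y k w <= x].
have mB : measurable B by exact: (@measurable_le _ _ _ (Y k) (cst x)).
have mU : measurable_fun setT (fun w => x - Y k w) by exact: measurable_funB.
have gB : generated_sigma [set k] Y B.
  rewrite (_ : B = Y k @^-1` `]-oo, x]); first exact: generated_sigma_preimage.
  by apply/seteqP; split => w /=; rewrite in_itv.
have aU : adapted (generators Y [set k]) (fun w => x - Y k w).
  exact: (@generators_adapted _ _ _ _ _ Y [set k] k (fun y => x - y) erefl
    (@measurable_funB _ _ _ _ (cst x) id (measurable_cst _) (@measurable_id _ _ _))).
have i1 : indep_on P (fun w => x - Y k w) B (psum k) setT.
  apply: (@indep_on_disjoint _ _ _ _ _ P Y [set k] [set j | j < k]%N) => //.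
  - exact: Y_iid.1.
  - by apply/seteqP; split => j //= [->]; rewrite ltnn.
  - exact: adapted_psum.
  - exact: generated_setT.
have i2 : indep_on P (fun w => x - Y k w) B (Y k.+1) setT.
  apply: (@indep_on_disjoint _ _ _ _ _ P Y [set k] [set k.+1]) => //.
  - exact: Y_iid.1.
  - by apply/seteqP; split => j //= [-> /eqP]; rewrite ltn_eqF.
  - exact: adapted_coordinate.
  - exact: generated_setT.
have cmp w : B w -> pr ([set v | x - Y k w < psum k v] `&` setT) <=
    c * pr ([set v | x - Y k w < Y k.+1 v] `&` setT).
  by move=> Bw; rewrite !setIT pr_gt_tail; apply: IH; rewrite subr_ge0.
have := pr_gt_le mU (mpsum k) (mY k.+1) mB measurableT measurableT i1 i2 c0 cmp.
rewrite setIT; set G := _ `&` B; set H := _ `&` B => GH.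
have mG : measurable G by apply: measurableI => //; exact: measurable_gt.
have mH : measurable H by apply: measurableI => //; exact: measurable_gt.
have mYk : measurable [set w | x < Y k w].
  exact: (@measurable_gt _ _ _ (Y k) (cst x)).
have : pr [set w | x < psum k.+1 w] <= pr [set w | x < Y k w] + pr G.
  rewrite (le_trans _ (prU_le P mYk mG))//; apply: le_pr.
  - exact: measurable_gt.
  - exact: measurableU.
  - move=> w /=; rewrite /G /B/= /psum big_ord_recr/= => h.
    by have [|] := ltP x (Y k w); [left|right; split => //; rewrite ltrBlDr].
have hH : pr H <= (1 + e) * Fb x.
  have mS2 : measurable_fun setT (fun w => Y k w + Y k.+1 w).
    exact: measurable_funD.
  have : pr [set w | x < Y k w + Y k.+1 w] = pr [set w | x < psum 2 w].
    rewrite /pr (_ : [set w | x < psum 2 w] = [set w | x < Y 0 w + Y 1 w]).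
      congr fine; apply: (@indep_sum_law _ _ _ P (Y k) (Y k.+1) (Y 0) (Y 1)
        [set z | x < z]) => //.
      + by apply: indep_Y_Y; rewrite ltn_eqF.
      + exact: indep_Y_Y.
      + by move=> S mS; rewrite !iid_law.
      + by move=> S mS; rewrite !iid_law.
      + rewrite (_ : [set z | _] = `]x, +oo[%classic)//.
        by apply/seteqP; split => z /=; rewrite in_itv/= andbT.
    by apply/seteqP; split => w /=; rewrite /psum !big_ord_recr big_ord0 /= add0r.
  have := hx0 _ x0x; rewrite -/(psum 2) => + h; rewrite -h => h2.
  have mD : measurable [set w | x < Y k w + Y k.+1 w] by exact: measurable_gt.
  have : pr ([set w | x < Y k w + Y k.+1 w] `&` [set w | x < Y k w]) = Fb x.
    rewrite -(pr_gt_tail k); congr pr; apply/seteqP; split => w /=; first by case.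
    by move=> xY; split => //; rewrite (lt_le_trans xY)// lerDl.
  have : pr H <= pr ([set w | x < Y k w + Y k.+1 w] `\` [set w | x < Y k w]).
    apply: le_pr => //; first exact: measurableD.
    move=> w [h3 h4]; split; first by move: h3; rewrite /= ltrBlDl.
    by apply/negP; rewrite -leNgt.
  have := prDI P mD mYk; move: h2; rewrite !mulrDl mul1r; lra.
rewrite pr_gt_tail; have := ler_wpM2l c0 hH.
have : 0 <= (Fb x0)^-1 * Fb x by rewrite mulr_ge0 ?invr_ge0 ?ltW ?tail_gt0.
by move: GH; rewrite /M !mulrDl mul1r; lra.
Qed.

End subexponential_sums.

(** * Arrival times and the renewal function *)

Section renewal_theory.
Context (d : measure_display) (W : measurableType d) (R : realType)
  (P : probability W R).
Variable theta : nat -> {mfun W >-> R}.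
Hypotheses (theta_ge0 : forall i w, 0 <= theta i w) (theta_iid : iid P theta).
Local Notation pr := (pr P).
Local Notation N := (counting_process theta).

Lemma arrivalE k w : arrival theta k w = \sum_(i < k) theta i w.
Proof.
rewrite /arrival; elim: k => [|k IH]; first by rewrite !big_ord0.
by rewrite !big_ord_recr/= -IH.
Qed.

Lemma arrivalS k w : arrival theta k.+1 w = arrival theta k w + theta k w.
Proof. by rewrite !arrivalE big_ord_recr. Qed.

Lemma arrival0 w : arrival theta 0 w = 0.
Proof. by rewrite arrivalE big_ord0. Qed.

Lemma le_arrival k l w : (k <= l)%N -> arrival theta k w <= arrival theta l w.
Proof.
move=> /subnK <-; elim: (l - k)%N => [|m IH] //.
by rewrite addSn arrivalS (le_trans IH)// lerDl.
Qed.

Lemma arrival_ge0 k w : 0 <= arrival theta k w.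
Proof. by rewrite -(arrival0 w) le_arrival. Qed.

Lemma measurable_arrival k : measurable_fun setT (arrival theta k).
Proof. exact: measurable_funP. Qed.

Lemma measurable_arrival_le k t : measurable [set w | arrival theta k w <= t].
Proof.
exact: (@measurable_le _ _ _ (arrival theta k) (cst t) (measurable_arrival k)).
Qed.

(** The inverse relation between arrival times and the counting process: it makes
    the arrival times measurable for the sigma-algebra generated by the counting
    process. *)
Lemma counting_process_ge k t w : 0 <= t ->
  (k%:R%:E <= N t w)%E <-> arrival theta k w <= t.
Proof.
move=> t0; split => [kN|kt]; last first.
  by apply: ereal_sup_ubound; exists k.
rewrite leNgt; apply/negP => tk; case: k => [|k] in kN tk.
  by rewrite arrival0 ltNge t0 in tk.
suff : (N t w <= k%:R%:E)%E.
  by move=> /(le_trans kN); rewrite lee_fin ler_nat ltnn.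
apply: ge_ereal_sup => _ [l /= lt <-]; rewrite lee_fin ler_nat -ltnS ltnNge.
by apply/negP => /(le_arrival w) /(lt_le_trans tk); rewrite ltNge lt.
Qed.

Lemma counting_process_eq m t w :
  arrival theta m w <= t < arrival theta m.+1 w -> N t w = m%:R%:E.
Proof.
move=> /andP[mt tm]; apply/eqP; rewrite eq_le; apply/andP; split.
  apply: ge_ereal_sup => _ [l /= lt <-]; rewrite lee_fin ler_nat -ltnS ltnNge.
  by apply/negP => /(le_arrival w) /(lt_le_trans tm); rewrite ltNge lt.
by apply: ereal_sup_ubound; exists m.
Qed.

Lemma counting_process_pinfty t w :
  (forall k, arrival theta k w <= t) -> N t w = +oo%E.
Proof.
move=> h; apply/eqyP => r /= r0.
apply: (@le_trans _ _ (Num.bound r)%:R%:E).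
  by rewrite lee_fin ltW// archi_boundP// ltW.
by apply: ereal_sup_ubound; exists (Num.bound r) => //; exact: h.
Qed.

(** Either infinitely many arrivals occur by time [t], or the number of arrivals is
    pinned down by two consecutive arrival times. *)
Lemma arrival_dichotomy t w : 0 <= t ->
  (forall k, arrival theta k w <= t) \/
  (exists m, arrival theta m w <= t < arrival theta m.+1 w).
Proof.
move=> t0; have [|/existsNP[k /negP kt]] := pselect (forall k, arrival theta k w <= t).
  by left.
right; have ex : exists k, ~~ (arrival theta k w <= t) by exists k.
case: (ex_minnP ex) => -[|m]; first by rewrite arrival0 t0.
move=> mt mmin; exists m; rewrite ltNge mt andbT; apply/negPn/negP => /mmin.
by rewrite ltnn.
Qed.

(** [<<s times_generators >>] is [generated_sigma `[0, +oo[ N]. *)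
Definition times_generators : set (set W) :=
  \bigcup_(t in `[0, +oo[%classic) preimage_set_system setT (N t) measurable.

(** For [t < 0], where the counting process says nothing, the event is empty. *)
Lemma arrival_le_generated k t :
  <<s times_generators >> [set w | arrival theta k w <= t].
Proof.
have [t0|t0] := ltP t 0.
  rewrite (_ : [set w | _] = set0); first exact: sigma_algebra0.
  apply/seteqP; split => w //= /le_lt_trans/(_ t0).
  by rewrite ltNge arrival_ge0.
rewrite (_ : [set w | _] = N t @^-1` [set` `[k%:R%:E, +oo%E]]); last first.
  by apply/seteqP; split => w /=; rewrite -counting_process_ge// in_itv/= leey andbT.
apply: sub_sigma_algebra; exists t; first by rewrite /= in_itv/= t0.
by exists [set` `[k%:R%:E, +oo%E]]; [exact: emeasurable_itv|rewrite setTI].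
Qed.

Lemma arrival_adapted k : adapted times_generators (arrival theta k).
Proof.
apply: (measurability _ (RGenOInfty.measurableE R)) => _ [_ [x ->] <-].
rewrite setTI (_ : _ @^-1` _ = ~` [set w | arrival theta k w <= x]).
  by apply: sigma_algebraC; exact: arrival_le_generated.
apply/seteqP; split => w /=; rewrite in_itv/= andbT ltNge.
  by move/negP.
by move=> /negP.
Qed.

(** Counting the arrivals one by one: the partial sums of the series never exceed
    the number of arrivals, and reach every [k] with [arrival k <= t]. *)
Lemma counting_processE t w : 0 <= t ->
  N t w = (\sum_(k <oo) (\1_[set w | arrival theta k.+1 w <= t] w)%:E)%E.
Proof.
move=> t0; pose f k := (\1_[set w | arrival theta k.+1 w <= t] w : R)%:E.
have f0 k : (0 <= f k)%E by rewrite lee_fin.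
have f1 k : (f k <= 1)%E by rewrite lee_fin /f indicE; case: (_ \in _).
apply/eqP; rewrite eq_le; apply/andP; split.
  apply: ge_ereal_sup => _ [k /= kt <-].
  apply: le_trans (@nneseries_lim_ge _ f xpredT 0%N k _) => //.
  rewrite big_mkord sumEFin lee_fin.
  rewrite (eq_bigr (fun=> 1)) ?sumr_const ?card_ord//.
  move=> i _; rewrite indicE mem_set//= (le_trans _ kt)//.
  exact: le_arrival.
apply: lime_le; first exact: is_cvg_nneseries.
apply: nearW => n; rewrite big_mkord; elim: n => [|n IH].
  rewrite big_ord0; apply: (counting_process_ge 0 w t0).2; by rewrite arrival0.
have [nt|tn] := leP (arrival theta n.+1 w) t.
  apply: le_trans ((counting_process_ge n.+1 w t0).2 nt).
  apply: (@le_trans _ _ (\sum_(i < n.+1) 1%:E)%E).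
    by apply: lee_sum => i _; exact: f1.
  by rewrite sumEFin sumr_const card_ord.
rewrite big_ord_recr/= indicE memNset ?adde0//=.
by apply/negP; rewrite -ltNge.
Qed.

Lemma renewal_functionE t : 0 <= t ->
  renewal_function P theta t =
  (\sum_(k <oo) P [set w | (arrival theta k.+1 w <= t)%R])%E.
Proof.
move=> t0; rewrite /renewal_function.
transitivity (\int[P]_w \sum_(k <oo)
    (\1_[set w | (arrival theta k.+1 w <= t)%R] w)%:E)%E.
  by apply: eq_integral => w _; rewrite counting_processE.
rewrite integral_nneseries//.
- apply: eq_eseriesr => k _; rewrite integral_indic ?setIT//.
  exact: measurable_arrival_le.
- move=> k; apply/measurable_EFinP; apply: measurable_indic.
  exact: measurable_arrival_le.
Qed.

(** The first arrival is the most likely one to happen by time [t]: if it has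
    probability [0], every term of the renewal series vanishes. *)
Lemma Lambda_gt0 t : Lambda P theta t -> 0 <= t /\
  0 < pr [set w | arrival theta 1 w <= t].
Proof.
move=> [t0]; rewrite renewal_functionE// => h; split => //.
rewrite lt_neqAle pr_ge0 andbT; apply/eqP => p0; move: h.
rewrite eseries0 ?ltxx// => k _ _.
apply/eqP; rewrite eq_le measure_ge0 andbT prE ?lee_fin ?p0.
  apply: le_pr; [exact: measurable_arrival_le|exact: measurable_arrival_le|].
  by move=> w /=; apply: le_trans; exact: le_arrival.
exact: measurable_arrival_le.
Qed.

Lemma renewal_partial_sum T n : 0 <= T -> (renewal_function P theta T < +oo)%E ->
  \sum_(k < n) pr [set w | arrival theta k.+1 w <= T] <=
  fine (renewal_function P theta T).
Proof.
move=> T0 fin; have fin' : renewal_function P theta T \is a fin_num.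
  rewrite ge0_fin_numE// renewal_functionE//; exact: nneseries_ge0.
rewrite -lee_fin fineK// renewal_functionE// -sumEFin.
apply: le_trans (@nneseries_lim_ge _ _ xpredT 0%N n _) => //.
by rewrite big_mkord; apply: lee_sum => k _; rewrite prE//;
  exact: measurable_arrival_le.
Qed.

(** Otherwise every term of the renewal series would be bounded away from [0]. *)
Lemma pr_explosion0 T : 0 <= T -> (renewal_function P theta T < +oo)%E ->
  pr (\bigcap_k [set w | arrival theta k w <= T]) = 0.
Proof.
move=> T0 fin; set E := \bigcap_k _; apply/eqP; rewrite eq_le pr_ge0 andbT.
rewrite leNgt; apply/negP => E0.
have mE : measurable E.
  by apply: bigcapT_measurable => k; exact: measurable_arrival_le.
pose n := Num.bound `|fine (renewal_function P theta T) / pr E|.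
have := renewal_partial_sum n T0 fin.
have : \sum_(k < n) pr E <= \sum_(k < n) pr [set w | arrival theta k.+1 w <= T].
  apply: ler_sum => k _; apply: le_pr => //; first exact: measurable_arrival_le.
  by move=> w; exact.
rewrite sumr_const card_ord -mulr_natl => /le_trans/[apply].
rewrite -ler_pdivlMr// leNgt (le_lt_trans (ler_norm _))// archi_boundP//.
Qed.

(** The time between the [i]-th and the [(i + l)]-th arrival. *)
Definition elapsed i l w := \sum_(k < l) theta (i + k)%N w.

Lemma arrivalD i l w :
  arrival theta (i + l) w = arrival theta i w + elapsed i l w.
Proof.
rewrite /elapsed; elim: l => [|l IH]; first by rewrite addn0 big_ord0 addr0.
by rewrite addnS arrivalS IH big_ord_recr/= addrA.
Qed.

Lemma elapsed0 l w : elapsed 0 l w = arrival theta l w.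
Proof. by rewrite arrivalE. Qed.

Lemma elapsed_ge0 i l w : 0 <= elapsed i l w.
Proof. by apply: sumr_ge0. Qed.

Lemma measurable_elapsed i l : measurable_fun setT (elapsed i l).
Proof. by apply: measurable_sum => k; exact: measurable_funP. Qed.

Lemma elapsed_adapted_times i l : adapted times_generators (elapsed i l).
Proof.
rewrite (_ : elapsed i l = fun w => arrival theta (i + l) w - arrival theta i w).
  by apply: measurable_funB; exact: arrival_adapted.
by apply/funext => w; rewrite arrivalD addrC addKr.
Qed.

Lemma elapsed_adapted (J : set nat) i l :
  (forall k, (k < l)%N -> J (i + k)%N) ->
  adapted (generators theta J) (elapsed i l).
Proof.
move=> lJ; rewrite /elapsed.
apply: (@adapted_sum _ _ _ _ _ (index_enum 'I_l) (fun k => theta (i + k)%N)).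
move=> k _; apply: adaptedP => S mS.
by apply: generated_sigma_preimage => //; exact: lJ.
Qed.

(** Stationarity of the increments, by adding one independent inter-arrival time
    at a time. *)
Lemma elapsed_law i l (S : set R) : measurable S ->
  P (elapsed i l @^-1` S) = P (arrival theta l @^-1` S).
Proof.
suff H j k : forall S, measurable S ->
    P (elapsed j k @^-1` S) = P (elapsed 0 k @^-1` S).
  move=> mS; rewrite H//; congr (P _).
  by apply/seteqP; split => w /=; rewrite elapsed0.
elim: k => [|k IH] {}S mS.
  by congr (P _); apply/seteqP; split => w; rewrite /elapsed/= !big_ord0.
have E a : elapsed a k.+1 @^-1` S =
    [set w | S (elapsed a k w + theta (a + k)%N w)].
  by apply/seteqP; split => w; rewrite /elapsed/= big_ord_recr.
have ind a : indep_on P (elapsed a k) setT (theta (a + k)%N) setT.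
  apply: (@indep_on_disjoint _ _ _ _ _ P theta [set b | b < a + k]%N [set (a + k)%N]).
  - exact: theta_iid.1.
  - by apply/seteqP; split => b //= [+ eb]; rewrite eb ltnn.
  - by apply: elapsed_adapted => b /= bk; rewrite ltn_add2l.
  - by apply: adaptedP => B mB; exact: generated_sigma_preimage.
  - exact: generated_setT.
  - exact: generated_setT.
rewrite !E; apply: indep_sum_law => //.
- exact: measurable_elapsed.
- exact: measurable_elapsed.
- move=> B mB; have := theta_iid.2 (j + k)%N B mB.
  by rewrite -(theta_iid.2 (0 + k)%N B mB).
Qed.

Lemma pr_elapsed_le i l t :
  pr [set w | elapsed i l w <= t] = pr [set w | arrival theta l w <= t].
Proof.
have := @elapsed_law i l `]-oo, t] (measurable_itv _).
by move=> h; rewrite /pr; congr fine; move: h; congr (_ = _); congr (P _);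
  apply/seteqP; split => w /=; rewrite in_itv.
Qed.

(** A sum of nonnegative times is at most [t] only if both summands are. *)
Lemma pr_arrivalD k l t :
  pr [set w | arrival theta (k + l) w <= t] <=
  pr [set w | arrival theta k w <= t] * pr [set w | arrival theta l w <= t].
Proof.
rewrite -(pr_elapsed_le k l t).
have ind : indep_on P (elapsed 0 k) setT (elapsed k l) setT.
  apply: (@indep_on_disjoint _ _ _ _ _ P theta [set b | b < k]%N [set b | k <= b]%N).
  - exact: theta_iid.1.
  - by apply/seteqP; split => b //= [bk]; rewrite leqNgt bk.
  - by apply: elapsed_adapted.
  - by apply: elapsed_adapted => b /= _; rewrite leq_addr.
  - exact: generated_setT.
  - exact: generated_setT.
have := @indep_on_pr _ _ _ _ _ _ _ _ `]-oo, t] `]-oo, t] ind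
  (measurable_elapsed 0 k) (measurable_elapsed k l) measurableT measurableT
  (measurable_itv _) (measurable_itv _).
rewrite !setIT.
rewrite (_ : elapsed 0 k @^-1` _ = [set w | arrival theta k w <= t]); last first.
  by apply/seteqP; split => w /=; rewrite in_itv/= elapsed0.
rewrite (_ : elapsed k l @^-1` _ = [set w | elapsed k l w <= t]); last first.
  by apply/seteqP; split => w /=; rewrite in_itv/=.
move=> <-; apply: le_pr.
- exact: measurable_arrival_le.
- apply: measurableI; first exact: measurable_arrival_le.
  exact: (@measurable_le _ _ _ (elapsed k l) (cst t) (measurable_elapsed k l)).
- move=> w /=; rewrite arrivalD; have := arrival_ge0 k w.
  by have := elapsed_ge0 k l w; split; lra.
Qed.

(** A geometric weight is absorbed by the submultiplicativity of
    [m |-> P (tau_m <= T)]: once [P (tau_q <= T) <= 1/2], shifting the weighted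
    sum by [q] multiplies it by at most [3/4]. *)
Lemma geometric_moment T : 0 <= T -> (renewal_function P theta T < +oo)%E ->
  exists2 e, 0 < e & exists B, forall n,
  \sum_(m < n) (1 + e) ^+ m * pr [set w | arrival theta m w <= T] <= B.
Proof.
move=> T0 fin; pose p m := pr [set w | arrival theta m w <= T].
have p0 m : 0 <= p m by exact: pr_ge0.
have p1 m : p m <= 1 by apply: pr_le1; exact: measurable_arrival_le.
have [q q0 pq] : exists2 q, (0 < q)%N & p q <= 2^-1.
  apply: contrapT => h.
  have hp k : 2^-1 <= p k.+1.
    by rewrite leNgt; apply/negP => pk; apply: h; exists k.+1 => //; exact: ltW.
  pose n := Num.bound `|fine (renewal_function P theta T) * 2|.
  have := renewal_partial_sum n T0 fin.
  have : \sum_(k < n) 2^-1 <= \sum_(k < n) p k.+1 :> R by apply: ler_sum.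
  rewrite sumr_const card_ord -mulr_natl.
  have : fine (renewal_function P theta T) * 2 < n%:R.
    by rewrite (le_lt_trans (ler_norm _))// archi_boundP.
  rewrite -/(p _); set a := fine _; set b := \sum_(i < n) _; set c := n%:R.
  by rewrite /b /p; lra.
have q0' : (0 : R) < q%:R by rewrite ltr0n.
have l0 : 0 < ln (3 / 2) :> R by rewrite ln_gt0//; lra.
(* [(1 + e) ^+ q <= expR (e * q) = 3 / 2] *)
pose e := ln (3 / 2) / q%:R : R.
have e0 : 0 < e by rewrite divr_gt0.
have e1 : 0 <= 1 + e by rewrite addr_ge0// ltW.
have eq32 : (1 + e) ^+ q <= 3 / 2.
  have -> : 3 / 2 = expR e ^+ q :> R.
    by rewrite -expRM_natl /e [q%:R * _]mulrC divfK ?gt_eqF// lnK// posrE; lra.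
  by apply: lerXn2r; rewrite ?nnegrE ?expR_ge0//; exact: expR_ge1Dx.
exists e => //.
pose A n := \sum_(m < n) (1 + e) ^+ m * p m.
have A0 m : 0 <= (1 + e) ^+ m * p m by rewrite mulr_ge0// exprn_ge0.
pose B := \sum_(m < q) (1 + e) ^+ m.
have AS n : A (q + n)%N <= B + 3 / 4 * A n.
  rewrite /A big_split_ord/=; apply: lerD.
    apply: ler_sum => m _; rewrite ler_piMr// ?exprn_ge0//; exact: p1.
  rewrite mulr_sumr; apply: ler_sum => m _.
  rewrite exprD; have pm : p (q + m)%N <= p m / 2.
    apply: le_trans (pr_arrivalD q m T) _; rewrite -/(p q) -/(p m) mulrC.
    by rewrite ler_wpM2l.
  have em : 0 <= (1 + e) ^+ m by rewrite exprn_ge0.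
  have eqq : 0 <= (1 + e) ^+ q by rewrite exprn_ge0.
  apply: (@le_trans _ _ ((3 / 2 * (1 + e) ^+ m) * (p m / 2))).
    apply: ler_pM => //; first exact: mulr_ge0.
    by rewrite ler_wpM2r.
  by rewrite le_eqVlt; apply/orP; left; apply/eqP; field.
exists (4 * B) => n; rewrite -/(A n).
have : A n <= A (q + n)%N.
  rewrite addnC /A big_split_ord/= lerDl.
  by apply: sumr_ge0 => i _; exact: (A0 (n + i)%N).
by have := AS n; lra.
Qed.

End renewal_theory.

(** * Asymptotics of discounted sums *)

Section discounted_sums.
Context (d : measure_display) (W : measurableType d) (R : realType)
  (P : probability W R).
Variables (Y theta : nat -> {mfun W >-> R}).
Hypotheses (Y_ge0 : forall i w, 0 <= Y i w) (Y_iid : iid P Y).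
Variable V : {measure set R -> \bar R}.
Hypothesis Y_law : forall S : set R, measurable S -> P (Y 0%N @^-1` S) = V S.
Hypothesis V_subexp : subexponential V.
Hypotheses (theta_ge0 : forall i w, 0 <= theta i w) (theta_iid : iid P theta).
Hypothesis Y_N_indep : independent_systems P (generated_sigma setT Y)
  <<s times_generators theta >>.
Variables (r T : R).
Hypotheses (r_ge0 : 0 <= r) (T_ge0 : 0 <= T).
Hypothesis renewal_fin : (renewal_function P theta T < +oo)%E.

Local Notation pr := (pr P).
Let Fb := tail V.
Let psum k w := \sum_(i < k) Y i w.
Let tau := arrival theta.

(** A claim paid at the [k]-th arrival has a discounted value above [x] exactly
    when its size exceeds this random level. *)
Definition level k x w := x * expR (r * tau k w).

(** Claims are numbered from [0]: claim [k] is paid at the [(k + 1)]-st arrival. *)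
Definition large_claim x t k : set W :=
  [set w | level k.+1 x w < Y k w] `&` [set w | tau k.+1 w <= t].

Let mY i : measurable_fun setT (Y i).
Proof. exact: measurable_funP. Qed.

Let mpsum k : measurable_fun setT (psum k).
Proof. by apply: measurable_sum => i; exact: mY. Qed.

Let mlevel_comp x : measurable_fun setT (fun a : R => x * expR (r * a)).
Proof.
by apply: measurable_funM => //; apply: measurableT_comp => //.
Qed.

Lemma measurable_level k x : measurable_fun setT (level k x).
Proof. exact: (measurableT_comp (mlevel_comp x) (measurable_arrival theta k)). Qed.

Lemma level_ge k x w : 0 <= x -> x <= level k x w.
Proof.
move=> x0; rewrite ler_peMr// -expR0 ler_expR mulr_ge0//.
exact: arrival_ge0.
Qed.

Lemma measurable_large_claim x t k : measurable (large_claim x t k).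
Proof.
apply: measurableI; last exact: measurable_arrival_le.
by apply: measurable_gt => //; exact: measurable_level.
Qed.

Lemma arrival_adapted_theta (J : set nat) k : (forall i, (i < k)%N -> J i) ->
  adapted (generators theta J) (tau k).
Proof.
move=> kJ; rewrite (_ : arrival theta k = elapsed theta 0 k :> (W -> R)).
  exact: elapsed_adapted.
by apply/funext => w; rewrite elapsed0.
Qed.

Let tau_le_theta (J : set nat) k t : (forall i, (i < k)%N -> J i) ->
  generated_sigma J theta [set w | tau k w <= t].
Proof.
move=> kJ; rewrite (_ : [set w | _] = tau k @^-1` `]-oo, t]).
  by apply: adapted_preimage => //; exact: arrival_adapted_theta.
by apply/seteqP; split => w /=; rewrite in_itv.
Qed.

Let elapsed_le_theta (J : set nat) i l t : (forall k, (k < l)%N -> J (i + k)%N) ->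
  generated_sigma J theta [set w | elapsed theta i l w <= t].
Proof.
move=> kJ; rewrite (_ : [set w | _] = elapsed theta i l @^-1` `]-oo, t]).
  by apply: adapted_preimage => //; exact: elapsed_adapted.
by apply/seteqP; split => w /=; rewrite in_itv.
Qed.

Let elapsed_le_times i l t :
  <<s times_generators theta >> [set w | elapsed theta i l w <= t].
Proof.
rewrite (_ : [set w | _] = elapsed theta i l @^-1` `]-oo, t]).
  by apply: adapted_preimage => //; exact: elapsed_adapted_times.
by apply/seteqP; split => w /=; rewrite in_itv.
Qed.

Let level_adapted G k x : adapted G (tau k) -> adapted G (level k x).
Proof. by move=> Gk; exact: (measurableT_comp (mlevel_comp x) Gk). Qed.

(** Joint independence of three blocks: the claims ([Z] and [D]), the first [k]
    inter-arrival times (the level and the truncation to [tau k <= t]), and the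
    later inter-arrival times ([D']). The first block is independent of the times
    altogether, the other two of each other. *)
Lemma indep_claims_past_future k x t (Z : W -> R) (D D' : set W) :
  adapted (generators Y setT) Z -> generated_sigma setT Y D ->
  generated_sigma [set i | k <= i]%N theta D' ->
  <<s times_generators theta >> D' ->
  indep_on P (level k x) [set w | tau k w <= t] Z (D `&` D').
Proof.
move=> YZ YD tD' nD' S S' mS mS'; set B := [set w | tau k w <= t].
have Ua : generated_sigma [set i | i < k]%N theta (level k x @^-1` S `&` B).
  apply: generated_setI; last exact: tau_le_theta.
  by apply: adapted_preimage => //; apply: level_adapted; exact: arrival_adapted_theta.
have Un : <<s times_generators theta >> (level k x @^-1` S `&` B).
  apply: generated_setI; last exact: arrival_le_generated.
  by apply: adapted_preimage => //; apply: level_adapted; exact: arrival_adapted.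
have YD1 : generated_sigma setT Y (Z @^-1` S' `&` D).
  by apply: generated_setI => //; exact: adapted_preimage.
have kk : [set i | i < k]%N `&` [set i | k <= i]%N = set0.
  by apply/seteqP; split => i //= [ik]; rewrite leqNgt ik.
have e1 := independent_generated theta_iid.1 kk Ua tD'.
have e2 := Y_N_indep YD1 (generated_setI Un nD').
have e3 := Y_N_indep YD1 nD'.
rewrite (setIA (Z @^-1` S')) e3 setIA [X in X `&` D']setIC -setIA e2 e1.
by rewrite muleCA.
Qed.

Lemma indep_claims_past k x t (Z : W -> R) (D : set W) :
  adapted (generators Y setT) Z -> generated_sigma setT Y D ->
  indep_on P (level k x) [set w | tau k w <= t] Z D.
Proof.
move=> YZ YD; apply: (indep_on_systems Y_N_indep) => S mS.
  by apply: generated_setI => //; exact: adapted_preimage.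
apply: generated_setI; last exact: arrival_le_generated.
by apply: adapted_preimage => //; apply: level_adapted; exact: arrival_adapted.
Qed.

(** Two claims both large: the second one exceeds [x], and independently a
    further stretch of inter-arrival times has length at most [T]. *)
Lemma pr_large_claimI x t k l : 0 <= x -> t <= T ->
  pr (large_claim x t k `&` large_claim x t (k + l).+1) <=
  Fb x * pr [set w | tau l.+1 w <= T] * pr (large_claim x t k).
Proof.
move=> x0 tT; set j := (k + l).+1.
pose D := [set w | x < Y j w].
pose D' := [set w | elapsed theta k.+1 l.+1 w <= T].
have gD : generated_sigma setT Y D.
  rewrite (_ : D = Y j @^-1` `]x, +oo[); first exact: generated_sigma_preimage.
  by apply/seteqP; split => w /=; rewrite in_itv/= andbT.
have mD : measurable D by exact: generated_sigma_measurable gD.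
have mD' : measurable D'.
  exact: (@measurable_le _ _ _ (elapsed theta k.+1 l.+1) (cst T)
    (measurable_elapsed theta _ _)).
have mB := measurable_arrival_le theta k.+1 t.
have gY i : adapted (generators Y setT) (Y i) by exact: adapted_coordinate.
have i1 : indep_on P (level k.+1 x) [set w | tau k.+1 w <= t] (Y k) (D `&` D').
  apply: indep_claims_past_future => //.
    by apply: elapsed_le_theta => i _ /=; rewrite leq_addr.
  exact: elapsed_le_times.
have i2 : indep_on P (level k.+1 x) [set w | tau k.+1 w <= t] (Y k) setT.
  by apply: indep_claims_past => //; exact: generated_setT.
have c0 : 0 <= Fb x * pr [set w | tau l.+1 w <= T].
  by rewrite mulr_ge0 ?pr_ge0// ltW// (tail_gt0 V_subexp).
have cmp w : [set w | tau k.+1 w <= t] w ->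
    pr ([set v | level k.+1 x w < Y k v] `&` (D `&` D')) <=
    Fb x * pr [set w | tau l.+1 w <= T] *
    pr ([set v | level k.+1 x w < Y k v] `&` setT).
  move=> _; set u := level k.+1 x w; rewrite setIT setIA.
  have mu : measurable [set v | u < Y k v].
    exact: (@measurable_gt _ _ _ (Y k) (cst u)).
  have gu : generated_sigma setT Y [set v | u < Y k v].
    rewrite (_ : [set v | _] = Y k @^-1` `]u, +oo[).
      exact: generated_sigma_preimage.
    by apply/seteqP; split => v /=; rewrite in_itv/= andbT.
  have e1 := Y_N_indep (generated_setI gu gD) (elapsed_le_times k.+1 l.+1 T).
  have e1' : pr ([set v | u < Y k v] `&` D `&` D') =
      pr ([set v | u < Y k v] `&` D) * pr D'.
    rewrite /pr [in LHS]e1 fineM// fin_num_measure//; exact: measurableI.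
  have kj : k != j by rewrite ltn_eqF// ltnS leq_addr.
  have e2 := @pr_indep_pair _ _ _ P Y Y_iid k j `]u, +oo[ `]x, +oo[ kj
    (measurable_itv _) (measurable_itv _).
  rewrite e1' (pr_elapsed_le theta_iid).
  have -> : pr ([set v | u < Y k v] `&` D) = pr [set v | u < Y k v] * pr D.
    move: e2; congr (pr _ = pr _ * pr _); apply/seteqP; split => v /=;
      by rewrite !in_itv/= !andbT.
  rewrite /D !(pr_gt_tail Y_iid Y_law) -/Fb -/tau.
  by rewrite le_eqVlt; apply/orP; left; apply/eqP; ring.
have := pr_gt_le (measurable_level k.+1 x) (mY k) (mY k) mB
  (measurableI _ _ mD mD') measurableT i1 i2 c0 cmp.
rewrite setIT; apply: le_trans; apply: le_pr.
- by apply: measurableI; exact: measurable_large_claim.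
- apply: measurableI; last by apply: measurableI => //; exact: measurableI.
  by apply: measurable_gt => //; exact: measurable_level.
- move=> w [[/= h1 h2] [h3 h4]]; split => //; split => //; split.
    by apply: le_lt_trans h3; exact: level_ge.
  have tE : tau j.+1 w = tau k.+1 w + elapsed theta k.+1 l.+1 w.
    by rewrite /tau -arrivalD /j addSn addnS.
  have := arrival_ge0 theta_ge0 k.+1 w; rewrite -/tau.
  by move: h4; rewrite /D'/= tE; lra.
Qed.

(** By [pr_large_claimI], the overlaps of one of the events with all later ones
    sum to at most its own probability times [Fb x] and the renewal function
    at [T]. *)
Lemma claims_lower_bound x t (F : set W) n : 0 <= x -> t <= T -> measurable F ->
  (forall k, large_claim x t k `<=` F) ->
  (1 - Fb x * fine (renewal_function P theta T)) *
    \sum_(k < n) pr (large_claim x t k) <= pr F.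
Proof.
move=> x0 tT mF EF; apply: pr_sum_le_overlap => //.
  by move=> k; exact: measurable_large_claim.
move=> k.
have F0 : 0 <= Fb x by rewrite ltW// (tail_gt0 V_subexp).
apply: (@le_trans _ _ (\sum_(l < n) Fb x * pr [set w | tau l.+1 w <= T] *
   pr (large_claim x t k))).
  by apply: ler_sum => l _; exact: pr_large_claimI.
rewrite -mulr_suml -mulr_sumr ler_wpM2r ?pr_ge0// ler_wpM2l//.
exact: renewal_partial_sum.
Qed.

Definition discounted_sum m w := \sum_(i < m) expR (- (r * tau i.+1 w)) * Y i w.

Let discount_le1 k w : expR (- (r * tau k w)) <= 1.
Proof.
rewrite -expR0 ler_expR oppr_le0 mulr_ge0//; exact: arrival_ge0.
Qed.

(** The first arrival has the largest discount factor. *)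
Lemma level_lt_psum x m w : x < discounted_sum m w -> level 1 x w < psum m w.
Proof.
have le1 : discounted_sum m w <= expR (- (r * tau 1 w)) * psum m w.
  rewrite /psum mulr_sumr; apply: ler_sum => i _; rewrite ler_wpM2r//.
  rewrite ler_expR lerN2 ler_wpM2l//; exact: le_arrival.
move=> /lt_le_trans/(_ le1); rewrite expRN mulrC ltr_pdivlMr// expR_gt0//.
Qed.

(** Discount factors are at most [1], so if all claims but the [i]-th add up to at
    most [K], these contribute at most [K]; the rest must come from claim [i],
    which has therefore been paid. *)
Lemma discounted_sum_other x m n i K w : (m <= n)%N -> K <= x ->
  other_sum Y n i w <= K -> x < discounted_sum m w ->
  (i < m)%N /\ x - K < expR (- (r * tau i.+1 w)) * Y i w.
Proof.
move=> mn Kx oK xs.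
pose c j := expR (- (r * tau j.+1 w)).
have cY j : 0 <= c j * Y j w by rewrite mulr_ge0// expR_ge0.
have rest : \sum_(j < m | j != i :> nat) c j * Y j w <= K.
  apply: le_trans oK; rewrite /other_sum !(big_mkcond (fun j => _ != i :> nat))/=.
  apply: (@le_trans _ _ (\sum_(j < m) (if j != i :> nat then Y j w else 0))).
    by apply: ler_sum => j _; case: ifP => // _; rewrite ler_piMl// discount_le1.
  apply: (@le_sum_ord _ (fun j => if j != i then Y j w else 0)) => // j.
  by case: ifP.
have [im|mi] := ltnP i m.
  split => //; move: xs; rewrite /discounted_sum (bigD1 (Ordinal im))//=.
  by move: rest; rewrite -/(c i); lra.
have : discounted_sum m w <= K.
  apply: le_trans rest; rewrite /discounted_sum [leRHS]big_mkcond/=.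
  apply: ler_sum => j _; case: ifPn => [//|/negPn/eqP ji].
  by move: (ltn_ord j); rewrite ji ltnNge mi.
lra.
Qed.

(** With at most [m0] claims, either all but one of them add up to at most [K]
    (the events [E1 i] of the proof), or none dominates ([E2]). With more claims
    ([E3]), Kesten's bound and the geometric decay of [P (tau m <= T)] apply. All
    three are compared with events [large_claim x t i], which makes the bound
    relative to the very series to be approximated. *)
Lemma claims_upper_bound (e : R) : 0 < e -> exists2 x0, 0 <= x0 &
  forall x t (F : set W), x0 <= x -> t <= T -> measurable F ->
  (forall w, F w -> exists m, tau m w <= t < tau m.+1 w /\
                              x < discounted_sum m w) ->
  exists n, pr F <= (1 + e) * \sum_(k < n) pr (large_claim x t k) +
                    (e + e) * pr (large_claim x t 0).
Proof.
move=> e0.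
pose p m := pr [set w | tau m w <= T].
have [q q0 [B hB]] := geometric_moment theta_ge0 theta_iid T_ge0 renewal_fin.
have [C C0 hC] := kesten_bound Y_ge0 Y_iid Y_law V_subexp q0.
have q1 : 0 < 1 + q by rewrite addr_gt0.
(* Kesten's factor for [m.+1] claims times the probability of [m] arrivals
     following the first one *)
pose a m := C * (1 + q) * ((1 + q) ^+ m * p m).
have a0 m : 0 <= a m.
  apply: mulr_ge0; first by rewrite mulr_ge0// ltW.
  by apply: mulr_ge0; [exact: exprn_ge0 (ltW q1)|exact: pr_ge0].
have aB n : \sum_(i < n) a i <= C * (1 + q) * B.
  rewrite /a -mulr_sumr; apply: ler_wpM2l; last exact: hB.
  by rewrite mulr_ge0// ltW.
have [m0 hm0] := bounded_series_tail a0 aB e0.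
have [K K0 [x1 x10 hx1]] := single_big_jump Y_ge0 Y_iid Y_law V_subexp m0 e0.
(* an amount [K] at time [0] is worth at most [h] at any time before [T] *)
pose h := K * expR (r * T).
have h0 : 0 <= h by rewrite mulr_ge0// expR_ge0.
have [x2 x20 hx2] := tail_long Y_ge0 Y_iid Y_law V_subexp h0 e0.
exists (Num.max K (Num.max x1 x2)); first by rewrite le_max K0.
move=> x t F; rewrite !ge_max => /and3P[Kx x1x x2x] tT mF FE.
have x0 : 0 <= x by exact: le_trans Kx.
have mB k := measurable_arrival_le theta k t.
have gY i : adapted (generators Y setT) (Y i) by exact: adapted_coordinate.
have gS i : adapted (generators Y setT) (psum i) by exact: adapted_psum.
have gT : generated_sigma setT Y setT by exact: generated_setT.
have ulevel k w u : u <= x -> u <= level k x w.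
  by move=> ux; apply: le_trans ux _; exact: level_ge.
have prY i u : pr [set w | u < Y i w] = Fb u by exact: pr_gt_tail.
pose ND := no_dominant_claim Y m0 K.
have gN : generated_sigma setT Y ND by exact: no_dominant_claim_generated.
have mN : measurable ND by exact: measurable_no_dominant_claim.
have mL k : measurable_fun setT (level k x) by exact: measurable_level.
have mYh i : measurable_fun setT (fun w => Y i w + h) by exact: measurable_funD.
have ind0 : indep_on P (level 1 x) [set w | tau 1 w <= t] (Y 0) setT.
  exact: indep_claims_past.
pose E1 i := [set w | level i.+1 x w < Y i w + h] `&` [set w | tau i.+1 w <= t].
pose E2 := [set w | level 1 x w < psum m0 w] `&` ([set w | tau 1 w <= t] `&` ND).
pose E3 m := [set w | level 1 x w < psum (m0 + m).+1 w] `&`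
             [set w | tau (m0 + m).+1 w <= t].
have mE1 i : measurable (E1 i) by apply: measurableI => //; exact: measurable_gt.
have mE2 : measurable E2.
  by apply: measurableI; [exact: measurable_gt|exact: measurableI].
have mE3 i : measurable (E3 i) by apply: measurableI => //; exact: measurable_gt.
have pE1 i : pr (E1 i) <= (1 + e) * pr (large_claim x t i).
  have i1 : indep_on P (level i.+1 x) [set w | tau i.+1 w <= t]
      (fun w => Y i w + h) setT.
    apply: indep_claims_past => //.
    exact: (@measurable_funD _ _ _ _ _ (cst h) (gY i)).
  have i2 : indep_on P (level i.+1 x) [set w | tau i.+1 w <= t] (Y i) setT.
    exact: indep_claims_past.
  have := @pr_gt_le _ _ _ P _ _ _ _ _ _ (1 + e) (mL i.+1) (mYh i) (mY i)
    (mB i.+1) measurableT measurableT i1 i2.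
  rewrite !setIT; apply; first by rewrite addr_ge0// ltW.
  move=> w _; rewrite !setIT prY.
  rewrite (_ : [set v | _] = [set v | level i.+1 x w - h < Y i v]).
    by rewrite prY; apply: hx2; exact: ulevel.
  by apply/seteqP; split => v /=; rewrite ltrBlDr.
have pE2 : pr E2 <= e * pr (large_claim x t 0).
  have i1 : indep_on P (level 1 x) [set w | tau 1 w <= t] (psum m0) ND.
    exact: indep_claims_past.
  have := @pr_gt_le _ _ _ P _ _ _ _ _ _ e (mL 1%N) (mpsum m0) (mY 0)
    (mB 1%N) mN measurableT i1 ind0 (ltW e0).
  rewrite !setIT; apply => w _; rewrite setIT prY.
  by apply: hx1; exact: ulevel.
have pE3 m : pr (E3 m) <= a (m0 + m)%N * pr (large_claim x t 0).
  set M := (m0 + m)%N; pose D' := [set w | elapsed theta 1 M w <= T].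
  have mD' : measurable D'.
    exact: (@measurable_le _ _ _ (elapsed theta 1 M) (cst T)
      (measurable_elapsed theta _ _)).
  have i1 : indep_on P (level 1 x) [set w | tau 1 w <= t] (psum M.+1) (setT `&` D').
    apply: indep_claims_past_future => //; first exact: elapsed_le_theta.
    exact: elapsed_le_times.
  have cmp w : [set w | tau 1 w <= t] w ->
      pr ([set v | level 1 x w < psum M.+1 v] `&` (setT `&` D')) <=
      a M * pr ([set v | level 1 x w < Y 0 v] `&` setT).
    move=> _; set u := level 1 x w; rewrite setIT setTI prY.
    have gu : generated_sigma setT Y [set v | u < psum M.+1 v].
      rewrite (_ : [set v | _] = psum M.+1 @^-1` `]u, +oo[).
        exact: adapted_preimage.
      by apply/seteqP; split => v /=; rewrite in_itv/= andbT.
    rewrite /pr (Y_N_indep gu (elapsed_le_times 1 M T)) fineM; last 2 first.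
    - by rewrite fin_num_measure//; exact: generated_sigma_measurable gu.
    - exact: fin_num_measure.
    rewrite -/(pr _) -/(pr _) (pr_elapsed_le theta_iid) -/(p M).
    have u0 : 0 <= u by exact: ulevel.
    rewrite -/tau -/(p M).
    apply: le_trans (ler_wpM2r (pr_ge0 P _) (hC M.+1 u u0)) _.
    by rewrite /a /p /Fb exprS le_eqVlt; apply/orP; left; apply/eqP; ring.
  have := pr_gt_le (mL 1%N) (mpsum M.+1) (mY 0) (mB 1%N)
    (measurableI _ _ measurableT mD') measurableT i1 ind0 (a0 M) cmp.
  rewrite setIT; apply: le_trans; apply: le_pr => //.
    apply: measurableI; first exact: measurable_gt.
    by apply: measurableI => //; exact: measurableI.
  move=> w [h1 /= h2]; split => //.
  have tE : tau M.+1 w = tau 1 w + elapsed theta 1 M w.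
    by rewrite /tau -arrivalD add1n.
  have := arrival_ge0 theta_ge0 1 w; rewrite -/tau.
  have := elapsed_ge0 theta_ge0 1 M w.
  by move: h2; rewrite /D'/= tE => h2 h3 h4; split; [lra|split => //=; lra].
have pE3U : pr (\bigcup_m E3 m) <= e * pr (large_claim x t 0).
  apply: pr_bigcup_series_le => // n.
  apply: (@le_trans _ _ (\sum_(i < n) a (m0 + i)%N * pr (large_claim x t 0))).
    by apply: ler_sum => i _; exact: pE3.
  by rewrite -mulr_suml ler_wpM2r ?pr_ge0.
have mE3U : measurable (\bigcup_m E3 m) by exact: bigcupT_measurable.
have mE1U : measurable (\bigcup_(i in [set i | i < m0]%N) E1 i).
  by apply: (@measurable_bigU _ _ E1).
have sub : F `<=` (\bigcup_(i in [set i | i < m0]%N) E1 i) `|`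
    (E2 `|` \bigcup_m E3 m).
  move=> w /FE[m [/andP[mt tm] xm]].
  have m_gt0 : (0 < m)%N.
    by case: m mt tm xm => // _ _; rewrite /discounted_sum big_ord0 ltNge x0.
  have [mm0|m0m] := leqP m m0; last first.
    have m0m1 : (m0 <= m.-1)%N by rewrite -ltnS prednK.
    right; right; exists (m.-1 - m0)%N => //.
    have mE : (m0 + (m.-1 - m0)).+1%N = m by rewrite subnKC// prednK.
    rewrite /E3 mE; split; last exact: mt.
    exact: level_lt_psum.
  have [ndw|/existsNP[i /not_implyP[im0 /negP]]] := pselect (ND w).
    right; left; split; last split => //=.
      apply: lt_le_trans (level_lt_psum xm) _.
      by apply: (@le_sum_ord _ (fun i => Y i w)).
    by apply: le_trans mt; exact: le_arrival.
  rewrite -leNgt => oK; left; exists i => //.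
  have [im xK] := discounted_sum_other mm0 Kx oK xm.
  have tit : tau i.+1 w <= t by apply: le_trans mt; exact: le_arrival.
  split => //=; rewrite /level.
  move: xK; rewrite expRN mulrC ltr_pdivlMr ?expR_gt0// mulrBl.
  have : K * expR (r * tau i.+1 w) <= h.
    by rewrite /h ler_wpM2l// ler_expR ler_wpM2l// (le_trans tit).
  by lra.
exists m0.
have h1 : pr F <= pr (\bigcup_(i in [set i | i < m0]%N) E1 i) +
    (pr E2 + pr (\bigcup_m E3 m)).
  apply: le_trans (le_pr P mF _ sub) _; first by do 2 apply: measurableU => //.
  apply: le_trans (prU_le P mE1U (measurableU _ _ mE2 mE3U)) _.
  by rewrite lerD2l; exact: prU_le.
have h2 : pr (\bigcup_(i in [set i | i < m0]%N) E1 i) <=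
    (1 + e) * \sum_(k < m0) pr (large_claim x t k).
  apply: le_trans (pr_bigcup_le P (fun i _ => mE1 i)) _.
  by rewrite mulr_sumr; apply: ler_sum => i _; exact: pE1.
by rewrite mulrDl; move: h1 h2 pE2 pE3U; lra.
Qed.

End discounted_sums.

(** * From claim vectors to claim sizes *)

Section claim_sizes.
Context (R : realType) (n : nat) (A : set 'rV[R]_n).
Hypothesis hA : ruin_family A.
Context (d : measure_display) (W : measurableType d) (P : probability W R).
Variable X : nat -> {mfun W >-> 'rV[R]_n}.

Lemma measurable_claim_size i : measurable_fun setT (gauge_sup A \o X i).
Proof.
by apply: (measurableT_comp (measurable_gauge_sup hA)); exact: measurable_funP.
Qed.

Definition claim_size i : {mfun W >-> R} :=
  mfun_Sub (mem_set (measurable_claim_size i)).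

Let mgauge (S : set R) : measurable S -> measurable (gauge_sup A @^-1` S).
Proof.
by move=> mS; have := measurable_gauge_sup hA measurableT mS; rewrite setTI.
Qed.

Lemma claim_size_iid : iid P X -> iid P claim_size.
Proof.
move=> [Xind Xid]; split.
  move=> J B mB.
  exact: (Xind J (fun i => gauge_sup A @^-1` B i) (fun i => mgauge (mB i))).
by move=> i B mB; exact: (Xid i _ (mgauge mB)).
Qed.

Lemma claim_size_generated :
  generated_sigma setT claim_size `<=` generated_sigma setT X.
Proof.
apply: smallest_sub; first exact: smallest_sigma_algebra.
move=> _ [i _ [B mB <-]]; rewrite setTI.
have h := @generated_sigma_preimage _ _ _ _ X setT i _ I (mgauge mB); exact: h.
Qed.

Lemma measurable_coord i j : measurable_fun setT (fun w => X i w 0 j).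
Proof.
apply: (measurability _ (RGenOpens.measurableE R)).
move=> _ [_ [a [b ->]] <-]; rewrite setTI.
have : measurable (X i @^-1` ((fun v : 'rV[R]_n => v 0 j) @^-1` `]a, b[)).
  rewrite -[X in measurable X]setTI; apply: measurable_funP => //.
  apply: sub_sigma_algebra; apply: open_comp; last exact: interval_open.
  by move=> v _; exact: coord_continuous.
by [].
Qed.

End claim_sizes.

(** * The renewal integral as a series *)

Section renewal_integral.
Context (d : measure_display) (W : measurableType d) (R : realType)
  (P : probability W R).
Variables (Y theta : nat -> {mfun W >-> R}).
Hypothesis Y_iid : iid P Y.
Variable V : probability R R.
Hypothesis Y_law : forall S : set R, measurable S -> P (Y 0%N @^-1` S) = V S.
Hypothesis theta_ge0 : forall i w, 0 <= theta i w.
Hypothesis Y_N_indep : independent_systems P (generated_sigma setT Y)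
  <<s times_generators theta >>.
Variable r : R.

(** Term by term, conditioning on the arrival time turns the integral of the tail
    against the law of the arrival time into the probability of a large claim. *)
Lemma integral_renewal_measure x t :
  (\int[renewal_measure P theta]_(s in `[0%R, t])
     V `](x * expR (r * s))%R, +oo[%classic =
   \sum_(k <oo) P (large_claim Y theta r x t k))%E.
Proof.
pose f (s : R) := V `](x * expR (r * s))%R, +oo[%classic.
have mC : measurable [set z : R * R | z.1 < z.2].
  exact: (@measurable_gt _ _ _ snd fst).
have mf : measurable_fun setT f.
  have mlev : measurable_fun setT (fun a : R => x * expR (r * a)).
    by apply: measurable_funM => //; apply: measurableT_comp.
  have := measurableT_comp (@measurable_fun_xsection _ _ _ _ R V _ mC) mlev.
  congr measurable_fun; apply/funext => s; rewrite /f /=; congr (V _).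
  by apply/seteqP; split => z /=; rewrite /xsection/= inE in_itv/= andbT.
have f0 s : (0 <= f s)%E by exact: measure_ge0.
transitivity (\int[mseries (fun k => distribution P (arrival theta k.+1)) 0]_(s in
    `[0%R, t]) f s)%E.
  apply: eq_measure_integral => S mS _; rewrite /= /mseries.
  rewrite -(@nneseries_addn _ (fun k => distribution P (arrival theta k) S) 1)//.
  by apply: eq_eseriesr => k _; rewrite addn1.
rewrite ge0_integral_measure_series//; last exact: measurable_funTS.
apply: eq_eseriesr => k _.
rewrite ge0_integral_pushforward//; last exact: measurable_funTS.
rewrite (_ : _ @^-1` _ = [set w | arrival theta k.+1 w <= t]); last first.
  apply/seteqP; split => w /=; rewrite in_itv/=; first by case/andP.
  by move=> ->; rewrite arrival_ge0.
rewrite /large_claim -[X in _ `&` X]setIT.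
have ind : indep_on P (level theta r k.+1 x) [set w | arrival theta k.+1 w <= t]
    (Y k) setT.
  apply: (indep_claims_past theta_ge0 Y_N_indep); first exact: adapted_coordinate.
  exact: generated_setT.
have := indep_on_section (measurable_level theta r k.+1 x) (measurable_funP (Y k))
  (measurable_arrival_le theta k.+1 t) measurableT mC ind.
move=> ->; apply: eq_integral => w _; rewrite setIT /f/= -(iid_law Y_iid Y_law k)//.
by congr (P _); apply/seteqP; split => v /=; rewrite in_itv/= andbT.
Qed.

End renewal_integral.

(** * The ruin event of the discounted claims *)

Section discounted_claims_event.
Context (R : realType) (n : nat) (A : set 'rV[R]_n).
Hypothesis hA : ruin_family A.
Context (d : measure_display) (W : measurableType d).
Variables (X : nat -> {mfun W >-> 'rV[R]_n}) (theta : nat -> {mfun W >-> R}).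
Hypothesis X_ge0 : forall i w, nonneg_vec (X i w).
Hypothesis theta_ge0 : forall i w, 0 <= theta i w.
Variable r : R.

Local Notation Y := (claim_size hA X).
Local Notation tau := (arrival theta).

Let vsum m w := \sum_(i < m) expR (- (r * tau i.+1 w)) *: X i w.

Lemma discounted_claims_eq m t w : tau m w <= t < tau m.+1 w ->
  discounted_claims theta X r t w = vsum m w.
Proof.
by move=> h; rewrite /discounted_claims (counting_process_eq theta_ge0 h)/= natrK.
Qed.

(** With infinitely many arrivals the number of summands is [truncn (fine +oo)],
    that is, [0]. *)
Lemma discounted_claims_explosion t w : (forall k, tau k w <= t) ->
  discounted_claims theta X r t w = 0.
Proof.
move=> h; rewrite /discounted_claims (counting_process_pinfty h)/=.
by rewrite truncn0 big_ord0.
Qed.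

Lemma claims_event_inv x t w : 0 < x -> 0 <= t ->
  scale_set x A (discounted_claims theta X r t w) ->
  exists m, tau m w <= t < tau m.+1 w /\ scale_set x A (vsum m w).
Proof.
move=> x0 t0; have [h|[m mt]] := arrival_dichotomy theta w t0.
  rewrite (discounted_claims_explosion h) (scale_setE A _ (lt0r_neq0 x0)).
  by rewrite scaler0 => /(ruin_family_not0 hA).
by rewrite (discounted_claims_eq mt) => ?; exists m.
Qed.

Lemma claims_event_discounted_sum x t w : 0 < x -> 0 <= t ->
  scale_set x A (discounted_claims theta X r t w) ->
  exists m, tau m w <= t < tau m.+1 w /\ x < discounted_sum Y theta r m w.
Proof.
move=> x0 t0 /(claims_event_inv x0 t0)[m [mt xA]]; exists m; split => //.
move/(lt_gauge_sup hA _ x0) : xA => /lt_le_trans; apply.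
by apply: gauge_sup_sum => // i; exact: expR_gt0.
Qed.

(** [A] is increasing, so the other claims cannot take the sum out of [x A]. The
    exceptional alternative, infinitely many arrivals, has probability [0]. *)
Lemma large_claim_event x t k w : 0 < x -> 0 <= t ->
  large_claim Y theta r x t k w ->
  scale_set x A (discounted_claims theta X r t w) \/ forall k, tau k w <= t.
Proof.
move=> x0 t0 [/= xY kt].
have [h|[m /[dup] mt /andP[_ tm]]] := arrival_dichotomy theta w t0.
  by right.
left; rewrite (discounted_claims_eq mt).
have km : (k < m)%N.
  rewrite -ltnS ltnNge; apply/negP => /(le_arrival theta_ge0 w).
  by move=> /(lt_le_trans tm); rewrite ltNge kt.
rewrite /vsum (bigD1 (Ordinal km))//=; apply: (scale_setD hA x0).
  move=> j; rewrite summxE; apply: sumr_ge0 => i _.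
  by rewrite mxE mulr_ge0 ?expR_ge0//; exact: X_ge0.
have c0 : 0 < expR (- (r * tau k.+1 w)) by exact: expR_gt0.
apply/(scale_set_scale A (X k w) (lt0r_neq0 c0) (lt0r_neq0 x0)).
apply/(lt_gauge_sup hA); first exact: divr_gt0.
by move: xY; rewrite /level expRN invrK.
Qed.

Lemma measurable_claims_event x t : 0 < x -> 0 <= t ->
  measurable [set w | scale_set x A (discounted_claims theta X r t w)].
Proof.
move=> x0 t0; rewrite (_ : [set w | _] = \bigcup_m
    ([set w | tau m w <= t] `&` [set w | t < tau m.+1 w] `&`
     vsum m @^-1` scale_set x A)); last first.
  apply/seteqP; split => w /=.
    move=> /(claims_event_inv x0 t0)[m [/andP[mt tm] xA]].
    by exists m => //; split => //; split.
  by move=> [m _ [[mt tm] xA]]; rewrite (@discounted_claims_eq m)// mt.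
apply: bigcupT_measurable => m; apply: measurableI.
  apply: measurableI; first exact: measurable_arrival_le.
  exact: (@measurable_gt _ _ _ (tau m.+1) (cst t) (measurable_arrival theta m.+1)).
apply: measurable_preimage_open; last exact: open_scale_set.
move=> j; rewrite (_ : (fun w => _) = fun w =>
    \sum_(i < m) expR (- (r * tau i.+1 w)) * X i w 0 j); last first.
  by apply/funext => w; rewrite /vsum summxE; apply: eq_bigr => i _; rewrite mxE.
apply: measurable_sum => i; apply: measurable_funM; last exact: measurable_coord.
apply: measurableT_comp => //; apply: measurableT_comp => //.
by apply: measurable_funM => //; exact: measurable_arrival.
Qed.

End discounted_claims_event.

(** * Uniform equivalence *)

Section uniform_limit.
Context (R : realType).

Lemma uniformly_equivalentP (f g : R -> R -> R) (E : set R) :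
  (forall e : R, 0 < e -> exists x0, forall x t, x0 <= x -> E t ->
    `|f x t / g x t - 1| <= e) ->
  uniformly_equivalent f g E.
Proof.
move=> h; rewrite /uniformly_equivalent.
set s := fun x => maxe 0%E (ereal_sup [set `|f x t / g x t - 1|%:E | t in E]).
have bound e : 0 < e -> \forall x \near +oo, (0 <= s x <= e%:E)%E.
  move=> e0; have [x0 hx0] := h _ e0.
  apply: filterS (nbhs_pinfty_ge (num_real x0)) => x x0x.
  rewrite /s le_max lexx/= ge_max lee_fin ltW//=.
  by apply: ge_ereal_sup => _ [t Et <-]; rewrite lee_fin; exact: hx0.
have fin e x : (0 <= s x <= e%:E)%E -> s x = (fine (s x))%:E.
  by move=> /andP[s0 se]; rewrite fineK// ge0_fin_numE// (le_lt_trans se)// ltry.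
apply/fine_cvgP; split.
  apply: filterS (bound 1 ltr01) => x /[dup] /andP[s0 _] /fin ->.
  by [].
apply/cvgrPdist_le => e e0.
apply: filterS (bound e e0) => x /[dup] /fin sE /andP[].
by rewrite sE !lee_fin sub0r normrN /= => s0 se; rewrite ger0_norm.
Qed.

End uniform_limit.

Theorem theorem3p1 (R : realType) (n : nat) (hn : (0 < n)%N)
  (A : set 'rV[R]_n) (hA : ruin_family A)
  (r : R) (hr : 0 <= r)
  (d : measure_display) (Omega : measurableType d) (P : probability Omega R)
  (F : probability 'rV[R]_n R)
  (X : nat -> {RV P >-> 'rV[R]_n}) (theta : nat -> {RV P >-> R})
  (X_ge0 : forall i w, nonneg_vec (X i w))
  (X_neq0 : forall i w, X i w <> 0)
  (X_iid : iid P X)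
  (X_law : forall B, measurable B -> distribution P (X 0%N) B = F B)
  (theta_ge0 : forall i w, 0 <= theta i w)
  (theta_iid : iid P theta)
  (theta_nondegenerate : (P [set w | theta 0%N w = 0%R] < 1)%E)
  (renewal_fin : forall t : R, 0 <= t -> (renewal_function P theta t < +oo)%E)
  (X_N_indep : independent_systems P
     (generated_sigma [set: nat] X)
     (generated_sigma `[0, +oo[ (counting_process theta)))
  (F_SA : subexponential_wrt A F)
  (T : R) (hT : Lambda P theta T) :
  uniformly_equivalent
    (fun x t => fine (P [set w | scale_set x A (discounted_claims theta X r t w)]))
    (fun x t => fine (\int[renewal_measure P theta]_(s in `[0%R, t])
                        F (scale_set (x * expR (r * s))%R A))%E)
    (Lambda P theta `&` `]0, T]).
Proof.
have T0 : 0 <= T by case: hT.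
pose Y := claim_size hA X.
have Y_ge0 i w : 0 <= Y i w by exact: gauge_sup_ge0.
have Y_iid : iid P Y by exact: claim_size_iid.
pose G : {mfun 'rV[R]_n >-> R} := mfun_Sub (mem_set (measurable_gauge_sup hA)).
pose V : probability R R := distribution F G.
have Y_law (S : set R) : measurable S -> P (Y 0%N @^-1` S) = V S.
  move=> mS; apply: (X_law (gauge_sup A @^-1` S)).
  by rewrite -[X in measurable X]setTI; exact: (measurable_gauge_sup hA).
have V_subexp : subexponential V by exact: F_SA.
have YN : independent_systems P (generated_sigma setT Y)
    <<s times_generators theta >>.
  by move=> B C /claim_size_generated GB HC; exact: X_N_indep.
pose lam := fine (renewal_function P theta T).
have lam0 : 0 <= lam.
  by have := renewal_partial_sum theta_ge0 0 T0 (renewal_fin T T0); rewrite big_ord0.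
apply: uniformly_equivalentP => e e0.
(* [1 / 2] keeps [1 - Fb x * lam] positive *)
pose e' := Num.min e (1 / 2).
have e'0 : 0 < e' by rewrite lt_min e0/=; lra.
have e'e : e' <= e by rewrite ge_min lexx.
have e'1 : e' <= 1 / 2 by rewrite ge_min lexx orbT.
have e3 : 0 < e / 3 by lra.
have e'l : 0 < e' / (lam + 1) by rewrite divr_gt0//; lra.
have [x1 x10 hx1] := claims_upper_bound Y_ge0 Y_iid Y_law V_subexp theta_ge0
  theta_iid YN hr T0 (renewal_fin T T0) e3.
have [x2 x20 hx2] := tail_cvg0 Y_iid Y_law e'l.
exists (Num.max 1 (Num.max x1 x2)) => x t; rewrite !ge_max => /and3P[x1x x1'x x2x].
have x0 : 0 < x by lra.
move=> [Lt]; rewrite /= in_itv/= => /andP[t_gt0 tT].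
have t0 : 0 <= t by exact: ltW.
pose E k := large_claim Y theta r x t k.
have mE k : measurable (E k) by exact: measurable_large_claim.
set L := [set w | _].
have mL : measurable L by exact: measurable_claims_event.
set rhs := (\int[_]_(s in _) _)%E.
have rhsE : rhs = (\sum_(k <oo) (pr P (E k))%:E)%E.
  rewrite /rhs; transitivity (\int[renewal_measure P theta]_(s in `[0%R, t])
     V `](x * expR (r * s))%R, +oo[%classic)%E.
    apply: eq_integral => s _; rewrite /V /distribution /pushforward/=.
    congr (F _); apply/seteqP; split => v /=; rewrite in_itv/= andbT;
      by move/(lt_gauge_sup hA _ (mulr_gt0 x0 (expR_gt0 _))).
  rewrite (integral_renewal_measure Y_iid Y_law theta_ge0 YN).
  by apply: eq_eseriesr => k _; exact: prE.
have rhs_ge m : ((\sum_(k < m) pr P (E k))%:E <= rhs)%E.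
  rewrite rhsE -sumEFin.
  apply: le_trans (@nneseries_lim_ge _ _ xpredT 0%N m _) => //.
    by rewrite big_mkord.
  by move=> k _ _; rewrite lee_fin pr_ge0.
have rhs_le c : (forall m, \sum_(k < m) pr P (E k) <= c) -> (rhs <= c%:E)%E.
  move=> hc; rewrite rhsE; apply: lime_le.
    by apply: is_cvg_nneseries => k _ _; rewrite lee_fin pr_ge0.
  by apply: nearW => m; rewrite big_mkord sumEFin lee_fin.
pose N := \bigcap_k [set w | arrival theta k w <= T].
have mN : measurable N.
  by apply: bigcapT_measurable => k; exact: measurable_arrival_le.
(* infinitely many arrivals by time [T] have probability [0] *)
have LN : pr P (L `|` N) <= pr P L.
  apply: le_trans (prU_le P mL mN) _.
  by rewrite (pr_explosion0 theta_ge0 T0 (renewal_fin T T0)) addr0.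
have ELN k : E k `<=` L `|` N.
  move=> w /(large_claim_event X_ge0 theta_ge0 x0 t0)[|h]; first by left.
  by right => l _ /=; exact: le_trans (h l) tT.
have lower := fun m => claims_lower_bound Y_iid Y_law V_subexp theta_ge0
  theta_iid YN hr T0 (renewal_fin T T0) m (ltW x0) tT (measurableU _ _ mL mN) ELN.
have [m0 upper] := hx1 x t L x1'x tT mL
  (fun w => @claims_event_discounted_sum _ _ _ hA _ _ X _ theta_ge0 r x t w x0 t0).
have lam_tail : tail V x * lam <= e'.
  have := hx2 _ x2x; have := tail_gt0 V_subexp x; set v := tail V x => v0 ve.
  have : v * (lam + 1) <= e' by rewrite -ler_pdivlMr//; lra.
  by rewrite mulrDr mulr1; lra.
pose c := 1 - tail V x * lam.
have c0 : 0 < c by rewrite /c; lra.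
have rhs_c : (rhs <= (pr P L / c)%:E)%E.
  by apply: rhs_le => m; rewrite ler_pdivlMr// mulrC; exact: le_trans (lower m) LN.
have rhs_fin : rhs \is a fin_num.
  rewrite ge0_fin_numE; first exact: le_lt_trans rhs_c (ltry _).
  by have := rhs_ge 0%N; rewrite big_ord0.
pose g := fine rhs.
have rhs_g : rhs = g%:E by rewrite fineK.
have g_ge m : \sum_(k < m) pr P (E k) <= g by rewrite -lee_fin -rhs_g.
have g_le : c * g <= pr P L.
  by rewrite mulrC -ler_pdivlMr// -lee_fin -rhs_g.
have pE0 : 0 < pr P (E 0).
  have [_ tau0] := Lambda_gt0 theta_ge0 Lt.
  pose u := x * expR (r * T).
  have gu : generated_sigma setT Y [set w | u < Y 0%N w].
    rewrite (_ : [set w | _] = Y 0%N @^-1` `]u, +oo[).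
      exact: generated_sigma_preimage.
    by apply/seteqP; split => w /=; rewrite in_itv/= andbT.
  have mu : measurable [set w | u < Y 0%N w] by exact: generated_sigma_measurable gu.
  have mt := measurable_arrival_le theta 1 t.
  have prod : pr P ([set w | u < Y 0%N w] `&` [set w | arrival theta 1 w <= t]) =
      pr P [set w | u < Y 0%N w] * pr P [set w | arrival theta 1 w <= t].
    rewrite /pr [in LHS](YN _ _ gu (arrival_le_generated theta_ge0 1 t)).
    by rewrite fineM// fin_num_measure.
  apply: (@lt_le_trans _ _ (pr P ([set w | u < Y 0%N w] `&`
      [set w | arrival theta 1 w <= t]))).
    rewrite prod mulr_gt0// (pr_gt_tail Y_iid Y_law); exact: tail_gt0.
  apply: le_pr => //; first exact: measurableI.
  move=> w [/= uY taut]; split => //=; apply: le_lt_trans uY.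
  rewrite /level /u ler_pM2l// ler_expR ler_wpM2l//; exact: le_trans taut tT.
have gE : pr P (E 0) <= g by have := g_ge 1%N; rewrite big_ord1.
have g0 : 0 < g by exact: lt_le_trans gE.
rewrite -/(pr P L) -/g.
have -> : pr P L / g - 1 = (pr P L - g) / g by field; rewrite gt_eqF.
rewrite normrM normfV (gtr0_norm g0) ler_pdivrMr// ler_norml; apply/andP; split.
  have : tail V x * lam * g <= e * g by rewrite ler_pM2r//; lra.
  by move: g_le; rewrite /c mulrBl mul1r; lra.
have h1 : (1 + e / 3) * \sum_(k < m0) pr P (E k) <= (1 + e / 3) * g.
  by rewrite ler_pM2l; [exact: g_ge|lra].
have h2 : (e / 3 + e / 3) * pr P (E 0) <= (e / 3 + e / 3) * g.
  by rewrite ler_pM2l//; lra.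
by move: upper h1 h2; rewrite -/(E 0) -/E; lra.
Qed.
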